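(* Let $(X,\mathcal{A},p)$ be an essentially standard Borel probability space. Consider the set of dagger idempotents on $(X,\mathcal{A},p)$ in $\mathsf{EKrn}$, i.e. a.s.-classes of measure-preserving kernels $e:(X,\mathcal{A},p)\to(X,\mathcal{A},p)$ with $e\circ e=e=e^+$ almost surely, partially ordered by $e\le f$ iff $e\circ f=f\circ e=e$ almost surely. Then: every increasing net $(e_\lambda)_{\lambda\in\Lambda}$ of such idempotents that is bounded above has a supremum $e$ in this order, and $e_\lambda\to e$ in the two-sided topology; and every decreasing net bounded below has an infimum $e$ and converges to it in the two-sided topology.
   Context: A Markov kernel $k:(X,\mathcal{A})\to(Y,\mathcal{B})$ assigns to $x\in X$, $B\in\mathcal{B}$ a number $k(B\mid x)\in[0,1]$, measurable in $x$ and a probability measure in $B$; composition is $(\ell\circ k)(C\mid x)=\int_Y\ell(C\mid y)\,k(dy\mid x)$. It is measure-preserving $(X,\mathcal{A},p)\to(Y,\mathcal{B},q)$ if $\int_X k(B\mid x)\,p(dx)=q(B)$ for all $B$; $k,h$ are $p$-a.s. equal if for each $B$, $k(B\mid x)=h(B\mid x)$ for $p$-a.a. $x$. $\mathsf{GKrn}$ is the category of probability spaces and a.s.-classes of measure-preserving kernels; a probability space is essentially standard Borel if isomorphic in $\mathsf{GKrn}$ to one with standard Borel underlying space, and $\mathsf{EKrn}$ is the corresponding full subcategory. The Bayesian inverse $k^+:(Y,\mathcal{B},q)\to(X,\mathcal{A},p)$ of $k$ is the (a.s. unique, existing in $\mathsf{EKrn}$) measure-preserving kernel with $\int_A k(B\mid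 x)\,p(dx)=\int_B k^+(A\mid y)\,q(dy)$ for all $A\in\mathcal{A},B\in\mathcal{B}$. A net $k_\lambda\to k$ in the one-sided topology iff $\int_X|k(B\mid x)-k_\lambda(B\mid x)|\,p(dx)\to0$ for all $B\in\mathcal{B}$; in the two-sided topology iff additionally $k_\lambda^+\to k^+$ in the one-sided topology. *)

(* Defs.v *)
From HB Require Import structures.
From mathcomp Require Import all_boot all_order all_algebra.
From mathcomp Require Import all_classical all_reals all_analysis.
Set Implicit Arguments. Unset Strict Implicit. Unset Printing Implicit Defensive.
Import Order.TTheory GRing.Theory Num.Theory.
Import numFieldNormedType.Exports.
Local Open Scope classical_set_scope.
Local Open Scope ring_scope.
Local Open Scope ereal_scope.

Section Defs.
Context (R : realType).

Definition kcompose d1 d2 d3 (X : measurableType d1) (Y : measurableType d2)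
  (Z : measurableType d3) (l : R.-pker Y ~> Z) (k : R.-pker X ~> Y)
  : X -> set Z -> \bar R :=
  fun x C => \int[k x]_y l y C.

Definition kid d1 (X : measurableType d1) : X -> set X -> \bar R :=
  fun x B => \d_x B.

Definition kae_eq d1 d2 (X : measurableType d1) (Y : measurableType d2)
  (p : probability X R) (k h : X -> set Y -> \bar R) : Prop :=
  forall B : set Y, measurable B -> {ae p, forall x, k x B = h x B}.

Definition meas_pres d1 d2 (X : measurableType d1) (Y : measurableType d2)
  (p : probability X R) (q : probability Y R) (k : R.-pker X ~> Y) : Prop :=
  forall B : set Y, measurable B -> \int[p]_x k x B = q B.

Definition bayes_inv d1 d2 (X : measurableType d1) (Y : measurableType d2)
  (p : probability X R) (q : probability Y R)
  (k : R.-pker X ~> Y) (h : R.-pker Y ~> X) : Prop :=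
  meas_pres q p h /\
  forall (A : set X) (B : set Y), measurable A -> measurable B ->
    \int[p]_(x in A) k x B = \int[q]_(y in B) h y A.

(** standard Borel measurable space: measurably isomorphic to a Polish space
    (separable, completely metrizable) with its Borel sigma-algebra *)
Definition standard_borel d (Y : measurableType d) : Prop :=
  exists (M : completePseudoMetricType R) (f : Y -> M),
    hausdorff_space M /\
    (exists D : set M, countable D /\ dense D) /\
    bijective f /\
    (forall B : set M, <<s [set O : set M | open O] >> B <-> measurable (f @^-1` B)).

(** essentially standard Borel: isomorphic in GKrn to a probability space
    with standard Borel underlying measurable space *)
Definition ess_std_borel d (X : measurableType d) (p : probability X R) : Prop :=
  exists d' (Y : measurableType d') (q : probability Y R),
    standard_borel Y /\
    exists (k : R.-pker X ~> Y) (h : R.-pker Y ~> X),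
      meas_pres p q k /\ meas_pres q p h /\
      kae_eq p (kcompose h k) (@kid _ X) /\
      kae_eq q (kcompose k h) (@kid _ Y).

Definition dagger_idem d (X : measurableType d) (p : probability X R)
  (e : R.-pker X ~> X) : Prop :=
  meas_pres p p e /\
  kae_eq p (kcompose e e) (fun x B => e x B) /\
  exists eplus : R.-pker X ~> X, bayes_inv p p e eplus /\ kae_eq p (fun x B => eplus x B) (fun x B => e x B).

Definition idem_le d (X : measurableType d) (p : probability X R)
  (e f : R.-pker X ~> X) : Prop :=
  kae_eq p (kcompose e f) (fun x B => e x B) /\
  kae_eq p (kcompose f e) (fun x B => e x B).

Definition directed (L : Type) (le : L -> L -> Prop) : Prop :=
  (forall l, le l l) /\
  (forall l m n, le l m -> le m n -> le l n) /\
  (exists l : L, True) /\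
  (forall l m, exists n, le l n /\ le m n).

Definition conv1 d1 d2 (X : measurableType d1) (Y : measurableType d2)
  (p : probability X R) (L : Type) (le : L -> L -> Prop)
  (kl : L -> R.-pker X ~> Y) (k : R.-pker X ~> Y) : Prop :=
  forall B : set Y, measurable B ->
  forall eps : R, (0 < eps)%R ->
  exists l0 : L, forall l, le l0 l ->
    \int[p]_x `|k x B - kl l x B| < eps%:E.

Definition conv2 d1 d2 (X : measurableType d1) (Y : measurableType d2)
  (p : probability X R) (q : probability Y R) (L : Type) (le : L -> L -> Prop)
  (kl : L -> R.-pker X ~> Y) (k : R.-pker X ~> Y) : Prop :=
  conv1 p le kl k /\
  forall (klp : L -> R.-pker Y ~> X) (kp : R.-pker Y ~> X),
    (forall l, bayes_inv p q (kl l) (klp l)) -> bayes_inv p q k kp ->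
    conv1 q le klp kp.

Definition is_sup_idem d (X : measurableType d) (p : probability X R)
  (L : Type) (el : L -> R.-pker X ~> X) (e : R.-pker X ~> X) : Prop :=
  dagger_idem p e /\ (forall l, idem_le p (el l) e) /\
  (forall f, dagger_idem p f -> (forall l, idem_le p (el l) f) -> idem_le p e f).

Definition is_inf_idem d (X : measurableType d) (p : probability X R)
  (L : Type) (el : L -> R.-pker X ~> X) (e : R.-pker X ~> X) : Prop :=
  dagger_idem p e /\ (forall l, idem_le p e (el l)) /\
  (forall f, dagger_idem p f -> (forall l, idem_le p f (el l)) -> idem_le p f e).

End Defs.

(* Main.v *)
(** A dagger idempotent [e] acts on L2 as an orthogonal projection, and [e <= f] means
    [<e 1_A, f 1_B> = <1_A, e 1_B>] for all [A, B]; hence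
    [||f 1_B - e 1_B||^2 = <1_B, f 1_B> - <1_B, e 1_B>], and a monotone net is L1-Cauchy on
    every measurable set. The algebraic identities pass to L1 limits, so everything reduces
    to realising the limit by a kernel. A Polish space is a measurable retract of the real
    line: code a point by the rational balls containing it and decode by completeness. This
    lets us push the net forward to kernels into [[0, 2]], take the limit of their
    distribution functions along a fast sequence (a limsup followed by a right-continuous
    regularisation, so no exceptional null set arises), and pull the limit kernel back. *)
Require Import Defs.
From HB Require Import structures.
From mathcomp Require Import all_boot all_order all_algebra.
From mathcomp Require Import all_classical all_reals all_analysis.
From mathcomp Require Import measurable_realfun.
From mathcomp Require Import ring lra.
Set Implicit Arguments. Unset Strict Implicit. Unset Printing Implicit Defensive.
Import Order.TTheory GRing.Theory Num.Theory.
Import numFieldNormedType.Exports.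
Local Open Scope classical_set_scope.
Local Open Scope ring_scope.

(** The obstacle is that an L1 limit exists for each set separately and only up to a null set, while
    a kernel must be additive over uncountably many sets at every point. On the line, countably many
    rational rays determine a measure, and one sequence of indices can handle them all. To return
    from that sequence to the whole net, and from rays to all Borel sets, some uniformity in the
    index is required. It comes from measure preservation: the average of [kval (T l) C] under [p]
    is the same for every [l], so a set of small average mass for one index has small average mass
    for all. This controls short intervals at the end of a ray and tails of disjoint unions. Almost
    sure identities are traded for equalities of integrals against indicators ([selfadj], [below]),
    so that passing to the limit is continuity of a pairing. Codes are written in base 3 with digits
    0 and 1, which makes digits unambiguous; they are at most 3/2, whence the interval from 0 to
    2. *)

Section bounded_measurable.
Context (R : realType) d (T : measurableType d).
Implicit Types (u v : T -> R) (mu : {measure set T -> \bar R}).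

(** The bound holds everywhere and not just almost everywhere, because the same function is
    integrated against [p] and against each measure [k x]. *)
Definition bdm u := measurable_fun setT u /\ exists M, forall x, `|u x| <= M.

Definition unitf u := measurable_fun setT u /\ forall x, 0 <= u x <= 1.

Lemma unitf_bdm u : unitf u -> bdm u.
Proof.
move=> [mu u01]; split => //; exists 1 => x.
by have /andP[u0 u1] := u01 x; rewrite ger0_norm.
Qed.

Lemma unitf_cst (c : R) : 0 <= c <= 1 -> unitf (fun=> c).
Proof. by move=> c01; split => //; exact: measurable_cst. Qed.

Lemma unitf_indic (A : set T) : measurable A -> unitf (\1_A : T -> R).
Proof.
move=> mA; split; first exact: measurable_indic.
by move=> x; rewrite indicE; case: (_ \in _); rewrite /= ?lexx ?ler01.
Qed.

Lemma unitfM u v : unitf u -> unitf v -> unitf (fun x => u x * v x).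
Proof.
move=> [mu u01] [mv v01]; split; first exact: measurable_funM.
move=> x; have /andP[u0 u1] := u01 x; have /andP[v0 v1] := v01 x.
by rewrite mulr_ge0//= mulr_ile1.
Qed.

Lemma bdm_cst (c : R) : bdm (fun=> c).
Proof. by split; [exact: measurable_cst|exists `|c|]. Qed.

Lemma bdmD u v : bdm u -> bdm v -> bdm (fun x => u x + v x).
Proof.
move=> [mu [M uM]] [mv [N vN]]; split; first exact: measurable_funD.
by exists (M + N) => x; rewrite (le_trans (ler_normD _ _))// lerD.
Qed.

Lemma bdmB u v : bdm u -> bdm v -> bdm (fun x => u x - v x).
Proof.
move=> [mu [M uM]] [mv [N vN]]; split; first exact: measurable_funB.
by exists (M + N) => x; rewrite (le_trans (ler_normB _ _))// lerD.
Qed.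

Lemma bdmM u v : bdm u -> bdm v -> bdm (fun x => u x * v x).
Proof.
move=> [mu [M uM]] [mv [N vN]]; split; first exact: measurable_funM.
by exists (M * N) => x; rewrite normrM ler_pM.
Qed.

Lemma bdmZ (c : R) u : bdm u -> bdm (fun x => c * u x).
Proof. exact/bdmM/bdm_cst. Qed.

Lemma bdm_norm u : bdm u -> bdm (fun x => `|u x|).
Proof.
move=> [mu [M uM]]; split; first exact: measurableT_comp.
by exists M => x; rewrite normr_id.
Qed.

Lemma bdm_sum n (u : nat -> T -> R) : (forall i, bdm (u i)) ->
  bdm (fun x => \sum_(i < n) u i x).
Proof.
move=> bu; elim: n => [|n ih].
  by under eq_fun do rewrite big_ord0; exact: bdm_cst.
by under eq_fun do rewrite big_ord_recr/=; exact: bdmD.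
Qed.

Section integral.
Variable mu : {measure set T -> \bar R}.
Hypothesis mu1 : mu setT = 1%E.

Lemma bdm_integrable u : bdm u -> mu.-integrable setT (EFin \o u).
Proof.
move=> [mfu [M uM]].
apply: measurable_bounded_integrable => //; first by rewrite mu1 ltey.
by exists M; split; [exact: num_real|move=> N MN x _; rewrite /= (le_trans (uM x))// ltW].
Qed.

Lemma bdm_EFin u : bdm u -> (\int[mu]_x u x)%:E = (\int[mu]_x (u x)%:E)%E.
Proof.
move=> bu; rewrite /Rintegral fineK//.
exact: integrable_fin_num (bdm_integrable bu).
Qed.

Lemma bdm_intD u v : bdm u -> bdm v ->
  \int[mu]_x (u x + v x) = \int[mu]_x u x + \int[mu]_x v x.
Proof. by move=> bu bv; rewrite RintegralD//; exact: bdm_integrable. Qed.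

Lemma bdm_intB u v : bdm u -> bdm v ->
  \int[mu]_x (u x - v x) = \int[mu]_x u x - \int[mu]_x v x.
Proof. by move=> bu bv; rewrite RintegralB//; exact: bdm_integrable. Qed.

Lemma bdm_intZ c u : bdm u -> \int[mu]_x (c * u x) = c * \int[mu]_x u x.
Proof. by move=> bu; rewrite RintegralZl//; exact: bdm_integrable. Qed.

Lemma bdm_int_cst c : \int[mu]_x c = c.
Proof. by rewrite Rintegral_cst// mu1 mulr1. Qed.

Lemma bdm_int_sum n (u : nat -> T -> R) : (forall i, bdm (u i)) ->
  \int[mu]_x (\sum_(i < n) u i x) = \sum_(i < n) \int[mu]_x u i x.
Proof.
move=> bu; elim: n => [|n ih].
  by under eq_Rintegral do rewrite big_ord0; rewrite bdm_int_cst big_ord0.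
under eq_Rintegral do rewrite big_ord_recr/=.
by rewrite bdm_intD ?ih ?big_ord_recr//; exact: bdm_sum.
Qed.

Lemma bdm_le_int u v : bdm u -> bdm v -> (forall x, u x <= v x) ->
  \int[mu]_x u x <= \int[mu]_x v x.
Proof. by move=> bu bv uv; apply: le_Rintegral => //; exact: bdm_integrable. Qed.

Lemma bdm_int_norm u : bdm u -> `|\int[mu]_x u x| <= \int[mu]_x `|u x|.
Proof. by move=> bu; apply: le_normr_Rintegral => //; exact: bdm_integrable. Qed.

Lemma bdm_int_le_cst u c : bdm u -> (forall x, u x <= c) -> \int[mu]_x u x <= c.
Proof.
move=> bu uc; rewrite -[leRHS]bdm_int_cst.
by apply: bdm_le_int => //; exact: bdm_cst.
Qed.

Lemma unitf_int01 u : unitf u -> 0 <= \int[mu]_x u x <= 1.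
Proof.
move=> uu; apply/andP; split.
  by apply: Rintegral_ge0 => x _; have /andP[] := uu.2 x.
by apply: bdm_int_le_cst; [exact: unitf_bdm|move=> x; have /andP[] := uu.2 x].
Qed.

Lemma int_indic A : measurable A -> \int[mu]_x \1_A x = fine (mu A).
Proof. by move=> mA; rewrite /Rintegral integral_indic// setIT. Qed.

Lemma int_mul_indic u A : measurable A -> bdm u ->
  (\int[mu]_(x in A) (u x)%:E)%E = (\int[mu]_x (\1_A x * u x))%:E.
Proof.
move=> mA bu; rewrite bdm_EFin; last exact/bdmM/bu/unitf_bdm/unitf_indic.
rewrite integral_mkcond; apply: eq_integral => x _.
by rewrite patchE indicE; case: ifPn; rewrite ?mul1r ?mul0r.
Qed.

(** The way back from integral identities to almost sure equality of kernels. *)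
Lemma bdm_ae_eq u v : bdm u -> bdm v ->
  (forall A, measurable A -> \int[mu]_x (\1_A x * u x) = \int[mu]_x (\1_A x * v x)) ->
  {ae mu, forall x, u x = v x}.
Proof.
move=> bu bv uv.
have : ae_eq mu setT (EFin \o u) (EFin \o v).
  apply: integral_ae_eq => //; first exact: bdm_integrable.
    by apply/measurable_EFinP; exact: bv.1.
  by move=> A _ mA; rewrite !int_mul_indic// uv.
by apply: filterS => x /(_ I) [].
Qed.

Lemma bdm_ae_int u v : bdm u -> bdm v -> {ae mu, forall x, u x = v x} ->
  \int[mu]_x u x = \int[mu]_x v x.
Proof.
move=> bu bv uv; congr fine; apply: ae_eq_integral => //.
- by apply/measurable_EFinP; exact: bu.1.
- by apply/measurable_EFinP; exact: bv.1.
- by apply: filterS uv => x ->.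
Qed.

End integral.
End bounded_measurable.

(** * Staircase approximation and averaging functionals *)

Section step_approximation.
Context (R : realType).

Lemma eps_eq0 (x : R) : (forall e, 0 < e -> `|x| <= e) -> x = 0.
Proof.
move=> h; apply/eqP; rewrite -normr_le0.
by apply/ler_addgt0Pr => e e0; rewrite add0r; exact: h.
Qed.

Lemma natSinv_lt (e : R) : 0 < e -> exists n, n.+1%:R^-1 < e.
Proof.
move=> e0; have [n _ /(_ n (leqnn n)) ne] := near_infty_natSinv_lt (PosNum e0).
by exists n.
Qed.

(** The sum counts the integers from 1 to [N] that do not exceed [v]: it is the integer part of
    [v]. *)
Lemma floor_sum N (v : R) : 0 <= v <= N%:R ->
  v - 1 <= \sum_(i < N) ((i.+1%:R <= v)%R : nat)%:R <= v.
Proof.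
elim: N => [|N ih] /andP[v0 vN]; first by rewrite big_ord0; lra.
rewrite big_ord_recr/=.
have [vN'|Nv] := leP v N%:R.
  rewrite (_ : (N.+1%:R <= v) = false) ?addr0; first by apply: ih; rewrite v0.
  by apply/negbTE; rewrite -ltNge (le_lt_trans vN')// ltr_nat.
rewrite (eq_bigr (fun=> 1)); last first.
  by move=> i _; rewrite (le_trans _ (ltW Nv))// ler_nat.
rewrite sumr_const card_ord.
move: vN; rewrite -natr1 => vN.
by case: (leP (N%:R + 1) v) => /= h; lra.
Qed.

Context d (T : measurableType d).
Definition layer (u : T -> R) n i : set T := [set y | i.+1%:R <= n.+1%:R * u y].

Lemma measurable_layer u n i : unitf u -> measurable (layer u n i).
Proof.
move=> [mu _]; rewrite -[X in measurable X]setTI.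
have := @measurable_fun_le _ _ _ setT (fun=> i.+1%:R) (fun y => n.+1%:R * u y).
apply => //; exact: measurable_funM.
Qed.

Definition step (u : T -> R) n (y : T) : R := n.+1%:R^-1 * \sum_(i < n.+1) \1_(layer u n i) y.

Lemma bdm_step u n : unitf u -> bdm (step u n).
Proof.
move=> uu; apply: bdmZ; apply: (bdm_sum _ (u := fun i => \1_(layer u n i))) => i.
exact/unitf_bdm/unitf_indic/measurable_layer.
Qed.

Lemma step_approx u n y : unitf u -> `|u y - step u n y| <= n.+1%:R^-1.
Proof.
move=> [_ /(_ y) /andP[u0 u1]].
have n0 : (0:R) < n.+1%:R by rewrite ltr0n.
have : 0 <= n.+1%:R * u y <= n.+1%:R.
  by rewrite mulr_ge0 ?ler0n//= ler_piMr// ler0n.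
move=> /floor_sum /andP[h1 h2].
have -> : u y - step u n y =
    n.+1%:R^-1 * (n.+1%:R * u y - \sum_(i < n.+1) ((i.+1%:R <= n.+1%:R * u y)%R : nat)%:R).
  rewrite mulrBr mulKf ?gt_eqF//; congr (_ - _ * _).
  by apply: eq_bigr => i _; rewrite indicE; congr ((_ : bool)%:R); apply/idP/idP; rewrite inE.
rewrite normrM ger0_norm ?invr_ge0// -[leRHS]mulr1 ler_pM2l ?invr_gt0//.
by rewrite ler_norml; lra.
Qed.

(* A function with values in [0, 1] is uniformly within [1/(n+1)] of the average of the
   indicators of its [n+1] upper layers; an averaging functional respects this
   approximation, hence is determined by its values on indicators. *)
Definition averaging (F : (T -> R) -> R) := forall u n, unitf u ->
  `|F u - n.+1%:R^-1 * \sum_(i < n.+1) F (\1_(layer u n i))| <= n.+1%:R^-1.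

Lemma averaging_eq F G : averaging F -> averaging G ->
  (forall B, measurable B -> F (\1_B) = G (\1_B)) ->
  forall u, unitf u -> F u = G u.
Proof.
move=> aF aG FG u uu; apply/eqP; rewrite -subr_eq0; apply/eqP.
apply: eps_eq0 => e e0; have e20 : 0 < e / 2 by rewrite divr_gt0.
have [n hn] := natSinv_lt e20.
have := aF u n uu; have := aG u n uu.
rewrite (eq_bigr (fun i : 'I_n.+1 => F (\1_(layer u n i)))); last first.
  by move=> i _; rewrite FG//; exact: measurable_layer.
set S := _ * _; move: S (n.+1%:R^-1) hn => S i hn.
rewrite !ler_norml => /andP[? ?] /andP[? ?].
by apply/andP; split; lra.
Qed.

End step_approximation.

(** * Kernels acting on functions, and their composition *)

Section kernel_operators.
Context (R : realType) d1 d2 (X : measurableType d1) (Y : measurableType d2).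
Implicit Types (k : R.-pker X ~> Y).

Definition kval k (B : set Y) (x : X) : R := fine (k x B).

Definition kop k (u : Y -> R) (x : X) : R := \int[k x]_y u y.

Lemma pker1 k x : k x setT = 1%E.
Proof. exact: prob_kernel. Qed.

Lemma kernel_le1 k x B : measurable B -> (k x B <= 1)%E.
Proof. by move=> mB; rewrite -(pker1 k x) le_measure ?inE. Qed.

Lemma kvalK k x B : measurable B -> (kval k B x)%:E = k x B.
Proof.
move=> mB; rewrite /kval fineK// fin_num_abs gee0_abs//.
by rewrite (le_lt_trans (kernel_le1 k x mB))// ltey.
Qed.

Lemma kop_indic k B : measurable B -> kop k \1_B = kval k B.
Proof. by move=> mB; apply/funext => x; rewrite /kop int_indic. Qed.

Lemma kop_EFin k u x : unitf u -> (kop k u x)%:E = (\int[k x]_y (u y)%:E)%E.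
Proof. by move=> uu; apply: bdm_EFin; [exact: prob_kernel|exact: unitf_bdm]. Qed.

Lemma unitf_kop k u : unitf u -> unitf (kop k u).
Proof.
move=> uu; split; last by move=> x; apply: unitf_int01 => //; exact: prob_kernel.
apply/measurable_EFinP.
under [X in measurable_fun _ X]eq_fun do rewrite /= kop_EFin//.
apply: measurable_fun_integral_kernel => //.
- by move=> U mU; exact: measurable_kernel.
- by move=> z; rewrite lee_fin; have /andP[] := uu.2 z.
- by apply/measurable_EFinP; exact: uu.1.
Qed.

Lemma unitf_kval k B : measurable B -> unitf (kval k B).
Proof. by move=> mB; rewrite -kop_indic//; exact/unitf_kop/unitf_indic. Qed.

(** At each [x] the error is [w x] times the error for the probability measure [k x], and [w x] is
    at most 1. *)
Lemma averaging_kop k (mu : {measure set X -> \bar R}) (w : X -> R) : mu setT = 1%E -> unitf w ->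
  averaging (fun u : Y -> R => \int[mu]_x (w x * kop k u x)).
Proof.
move=> mu1 uw u n uu.
have blk i : bdm (fun x => w x * kop k \1_(layer u n i) x).
  by apply: unitf_bdm; apply: unitfM => //; apply/unitf_kop/unitf_indic/measurable_layer.
have bku : bdm (fun x => w x * kop k u x) by apply/unitf_bdm/unitfM/unitf_kop.
rewrite -(bdm_int_sum mu1 n.+1 blk) -bdm_intZ//; last exact: bdm_sum blk.
rewrite -bdm_intB//; last exact/bdmZ/(bdm_sum _ blk).
have bI : bdm (fun x => w x * kop k u x -
    n.+1%:R^-1 * \sum_(i < n.+1) w x * kop k \1_(layer u n i) x).
  exact/bdmB/bdmZ/(bdm_sum _ blk).
apply: (le_trans (bdm_int_norm _ _)) => //.
apply: bdm_int_le_cst => //; first exact: bdm_norm.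
move=> x; rewrite -mulr_sumr mulrCA -mulrBr normrM.
have /andP[w0 w1] := uw.2 x.
rewrite ger0_norm// -[leRHS]mul1r ler_pM//.
have k1 := pker1 k x.
have bl i : bdm (\1_(layer u n i) : Y -> R).
  exact/unitf_bdm/unitf_indic/measurable_layer.
rewrite /kop -(bdm_int_sum k1 n.+1 bl) -bdm_intZ//; last exact: bdm_sum bl.
rewrite -bdm_intB//; [|exact: unitf_bdm|exact: bdm_step].
apply: (le_trans (bdm_int_norm _ _)) => //.
  by apply: bdmB; [exact: unitf_bdm|exact: bdm_step].
apply: bdm_int_le_cst => //.
  by apply/bdm_norm/bdmB; [exact: unitf_bdm|exact: bdm_step].
by move=> y; exact: step_approx.
Qed.

Lemma averaging_mul (mu : {measure set Y -> \bar R}) (w : Y -> R) : mu setT = 1%E -> unitf w ->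
  averaging (fun u : Y -> R => \int[mu]_y (u y * w y)).
Proof.
move=> mu1 uw u n uu.
have bl i : bdm (fun x => \1_(layer u n i) x * w x).
  by apply: unitf_bdm; apply: unitfM => //; exact/unitf_indic/measurable_layer.
have bu : bdm (fun x => u x * w x) by exact/unitf_bdm/unitfM.
rewrite -(bdm_int_sum mu1 n.+1 bl) -bdm_intZ//; last exact: bdm_sum bl.
rewrite -bdm_intB//; last exact/bdmZ/(bdm_sum _ bl).
apply: (le_trans (bdm_int_norm _ _)) => //; first exact/bdmB/bdmZ/(bdm_sum _ bl).
apply: bdm_int_le_cst => //; first exact/bdm_norm/bdmB/bdmZ/(bdm_sum _ bl).
move=> x; rewrite -mulr_suml mulrA -mulrBl normrM.
have /andP[w0 w1] := uw.2 x.
by rewrite [`|w x|]ger0_norm// -[leRHS]mulr1 ler_pM//; exact: step_approx.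
Qed.

Lemma averaging_int (mu : {measure set Y -> \bar R}) : mu setT = 1%E ->
  averaging (fun u : Y -> R => \int[mu]_y u y).
Proof.
move=> mu1 u n uu; have := @averaging_mul mu (fun=> 1) mu1.
have -> : (fun u : Y -> R => \int[mu]_y (u y * 1)) = (fun u => \int[mu]_y u y).
  by apply/funext => v; under eq_Rintegral do rewrite mulr1.
by apply => //; apply: unitf_cst; rewrite ler01 lexx.
Qed.

(** Each of the two functions is within [1/(n+1)] of its average over the layers, whence the first
    term. Only finitely many sets occur, so that in a net a single index can serve them all. *)
Lemma kop_dist k k' (mu : {measure set X -> \bar R}) u n : mu setT = 1%E -> unitf u ->
  \int[mu]_x `|kop k u x - kop k' u x| <= n.+1%:R^-1 *+ 2 +
  n.+1%:R^-1 * \sum_(i < n.+1) \int[mu]_x `|kval k (layer u n i) x - kval k' (layer u n i) x|.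
Proof.
move=> mu1 uu.
have bk (h : R.-pker X ~> Y) : bdm (kop h u) by exact/unitf_bdm/unitf_kop.
have bl (h : R.-pker X ~> Y) i : bdm (kval h (layer u n i)).
  exact/unitf_bdm/unitf_kval/measurable_layer.
have bd i : bdm (fun x => `|kval k (layer u n i) x - kval k' (layer u n i) x|).
  exact/bdm_norm/bdmB.
rewrite -(bdm_int_sum mu1 n.+1 bd) -bdm_intZ//; last exact: bdm_sum bd.
rewrite -[X in X + _](bdm_int_cst mu1) -bdm_intD//; last 2 first.
- exact: bdm_cst.
- exact/bdmZ/(bdm_sum _ bd).
apply: bdm_le_int => //; first exact/bdm_norm/bdmB.
  by apply: bdmD; [exact: bdm_cst|exact/bdmZ/(bdm_sum _ bd)].
move=> x.
have h (g : R.-pker X ~> Y) :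
    `|kop g u x - n.+1%:R^-1 * \sum_(i < n.+1) kval g (layer u n i) x| <= n.+1%:R^-1.
  have := averaging_int (pker1 g x) n uu.
  rewrite (eq_bigr (fun i : 'I_n.+1 => kval g (layer u n i) x))//.
  by move=> i _; rewrite int_indic//; exact: measurable_layer.
have := h k; have := h k'.
have : `|n.+1%:R^-1 * \sum_(i < n.+1) kval k (layer u n i) x -
         n.+1%:R^-1 * \sum_(i < n.+1) kval k' (layer u n i) x| <=
       n.+1%:R^-1 * \sum_(i < n.+1) `|kval k (layer u n i) x - kval k' (layer u n i) x|.
  rewrite -mulrBr -sumrB normrM ger0_norm ?invr_ge0//.
  by rewrite ler_wpM2l ?invr_ge0// ler_norm_sum.
set S := _ * _; set S' := _ * _; set D := _ * _.
move: S S' D (n.+1%:R^-1) => S S' D i.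
rewrite !ler_norml => /andP[? ?] /andP[? ?] /andP[? ?].
by apply/andP; split; lra.
Qed.

End kernel_operators.

Section kernel_composition.
Context (R : realType) d1 d2 d3 (X : measurableType d1) (Y : measurableType d2)
  (Z : measurableType d3).
Variables (l : R.-pker Y ~> Z) (k : R.-pker X ~> Y).

Definition pkcomp : X -> {measure set Z -> \bar R} := mkcomp_noparam k l.

HB.instance Definition _ := SubProbabilityKernel.on pkcomp.

Let pkcompT x : pkcomp x [set: Z] = 1%E.
Proof.
rewrite /pkcomp /mkcomp_noparam /= /kcomp_noparam.
under eq_integral do rewrite prob_kernel.
by rewrite integral_cst// mul1e prob_kernel.
Qed.

HB.instance Definition _ := isProbabilityKernel.Build _ _ _ _ _ pkcomp pkcompT.

Lemma pkcompE x B : pkcomp x B = (\int[k x]_y l y B)%E.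
Proof. by []. Qed.

Lemma kval_pkcomp B : measurable B -> kval pkcomp B = kop k (kval l B).
Proof.
move=> mB; apply/funext => x; rewrite /kval pkcompE /kop /Rintegral; congr fine.
by apply: eq_integral => y _; rewrite kvalK.
Qed.

(** Both sides are averaging functionals of [u] that agree on indicators. *)
Lemma kop_pkcomp u : unitf u -> kop pkcomp u = kop k (kop l u).
Proof.
move=> uu; apply/funext => x; rewrite /kop.
have := averaging_kop l (pker1 k x) (unitf_cst Y (c := 1) _).
rewrite ler01 lexx => /(_ isT) a.
have := averaging_eq (averaging_int (pker1 pkcomp x)) a.
move=> -> //.
  by apply: eq_Rintegral => y _; rewrite mul1r.
move=> B mB; under [RHS]eq_Rintegral do rewrite mul1r.
rewrite -[LHS]/(kop pkcomp \1_B x) kop_indic// kval_pkcomp//.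
by rewrite kop_indic.
Qed.

End kernel_composition.

Lemma measurable_cst_set d (T : measurableType d) (P : Prop) : measurable [set _ : T | P].
Proof.
have [p|np] := pselect P.
  by rewrite (_ : [set _ | P] = setT)//; apply/seteqP; split.
by rewrite (_ : [set _ | P] = set0)//; apply/seteqP; split.
Qed.

(** * Coding bit sequences by real numbers *)

Section ternary_code.
Context (R : realType).

(** Partial sums of a base 3 expansion whose leading digit has weight 1. The digits after it
    contribute at most 1/2, so the leading digit is 1 exactly when the code is at least 1; base 2
    would leave ties. *)
Fixpoint code_rec n (b : nat -> bool) : R :=
  if n is n'.+1 then (b 0%N)%:R + code_rec n' (fun i => b i.+1) / 3 else 0.

Definition code (b : nat -> bool) : R := limn (code_rec ^~ b).

Lemma code_rec_bound n b : 0 <= code_rec n b <= 3 / 2.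
Proof.
elim: n b => [|n ih] b /=; first lra.
have /andP[] := ih (fun i => b i.+1); case: (b 0%N) => /= h1 h2; lra.
Qed.

Lemma code_rec_cvg b : code_rec ^~ b @ \oo --> code b.
Proof.
apply: nondecreasing_is_cvgn; last first.
  by exists (3 / 2) => _ [n _ <-]; have /andP[] := code_rec_bound n b.
apply/nondecreasing_seqP => n; elim: n b => [|n ih] b.
  by have /andP[] := code_rec_bound 1 b.
rewrite [code_rec n.+1 b]/= [code_rec n.+2 b]/=.
by rewrite lerD2l ler_pM2r ?invr_gt0//; exact: ih.
Qed.

Lemma code_bound b : 0 <= code b <= 3 / 2.
Proof.
apply/andP; split.
  apply: limr_ge; first by apply/cvg_ex; exists (code b); exact: code_rec_cvg.
  by apply: nearW => n; have /andP[] := code_rec_bound n b.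
apply: limr_le; first by apply/cvg_ex; exists (code b); exact: code_rec_cvg.
by apply: nearW => n; have /andP[] := code_rec_bound n b.
Qed.

Lemma code_cons b : code b = (b 0%N)%:R + code (fun i => b i.+1) / 3.
Proof.
have := @code_rec_cvg b; rewrite -cvg_shiftS /= => h1.
apply: (cvg_unique _ h1) => //.
apply: cvgD; first exact: cvg_cst.
by apply: cvgMl; exact: code_rec_cvg.
Qed.

(** On codes this is the left shift: it removes the leading digit and rescales the rest. *)
Definition shift_code (r : R) : R := 3 * (r - \1_`[1, +oo[ r).

Definition digit n (r : R) : bool := 1 <= iter n shift_code r.

Lemma digit_code n b : digit n (code b) = b n.
Proof.
have head c : (1 <= code c) = c 0%N.
  rewrite code_cons; move: (code _) (code_bound (fun i => c i.+1)) => x /andP[? ?].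
  case: (c 0%N) => /=; first by apply/idP; lra.
  by apply/negbTE; rewrite -ltNge; lra.
elim: n b => [|n ih] b; first exact: head.
rewrite /digit iterSr -/(digit n _).
suff -> : shift_code (code b) = code (fun i => b i.+1) by exact: ih.
rewrite /shift_code indicE mem_setE in_itv/= andbT head code_cons.
by field.
Qed.

Lemma measurable_digit n : measurable [set r | digit n r].
Proof.
have m : measurable_fun setT (iter n shift_code).
  elim: n => [|n ih]; first exact: measurable_id.
  rewrite [iter n.+1 _](_ : _ = shift_code \o iter n shift_code)//.
  apply: measurableT_comp => //; apply: measurable_funM => //.
  apply: measurable_funB => //; exact: measurable_indic.
have := @measurable_fun_le _ _ R setT (fun=> 1) (iter n shift_code) measurableT.
by rewrite setTI; apply.
Qed.

Lemma measurable_code d (Y : measurableType d) (b : Y -> nat -> bool) :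
  (forall i, measurable [set y | b y i]) -> measurable_fun setT (fun y => code (b y)).
Proof.
move=> mb; apply: (@measurable_fun_cvg _ _ _ _ (fun n y => code_rec n (b y))); last first.
  by move=> y _; exact: code_rec_cvg.
move=> n; elim: n b mb => [|n ih] b mb; first exact: measurable_cst.
apply: measurable_funD; last first.
  by apply: measurable_funM => //; apply: (ih (fun y i => b y i.+1)) => i; exact: mb.
rewrite (_ : (fun y => _) = (\1_[set y | b y 0%N] : Y -> R)).
  exact: measurable_indic.
by apply/funext => y; rewrite indicE mem_setE.
Qed.

End ternary_code.

(** * Polish spaces as measurable retracts of the line *)

Section polish_retract.
Context (R : realType) (M : completePseudoMetricType R) (a : nat -> M).
Hypothesis hM : hausdorff_space M.
Hypothesis da : forall (z : M) (e : R), 0 < e -> exists m, ball z e (a m).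

Let r n : R := n.+1%:R^-1.
Let r_gt0 n : 0 < r n. Proof. by rewrite invr_gt0. Qed.
Let dig (n m : nat) (t : R) := digit (pickle (n, m)) t.

(* The digits of a good code name, for each radius, at least one center [a m], and the
   named balls are close enough to each other to pin down a single point of [M]. *)
Let good : set R := [set t | (forall n, exists m, dig n m t) /\
  forall n m n' m', dig n m t -> dig n' m' t -> ball (a m) (r n + r n') (a m')].

(** The radius is doubled because a limit of named centers may leave the original balls. *)
Let near_named (t : R) : set M :=
  [set z | forall n m, dig n m t -> ball (a m) (r n *+ 2) z].

(** Bad codes go to [a 0], which keeps the map total and adds one measurable piece to a preimage. *)
Let decode (t : R) : M := xget (a 0) [set z | good t /\ near_named t z].

(** Compatibility of the named balls makes any choice of centers, one per radius, a Cauchy sequence;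
    completeness supplies the point. *)
Let near_named_lim (t : R) : good t -> exists z, near_named t z.
Proof.
move=> [/choice[m mt] gt].
have cz : cauchy (a (m n) @[n --> \oo]).
  apply: cauchy_exP => e e0; have e20 : 0 < e / 2 by rewrite divr_gt0.
  have [N hN] := natSinv_lt e20; exists (a (m N)); exists N => // n /= Nn.
  apply: le_ball (gt _ _ _ _ (mt N) (mt n)).
  have : r n <= r N by rewrite lef_pV2 ?posrE// ler_nat ltnS.
  by rewrite -/(r N) in hN; lra.
have az := iffLR (cvg_ballP _ _) (@cauchy_cvg M _ _ cz).
pose z := lim (a (m n) @[n --> \oo]); exists z => n k nk.
(* [r n.*2.+1] is half of [r n]; with [j] at least [n.*2.+1], the errors [r j] and [r n.*2.+1]
   together cost at most [r n]. *)
have [N _ hN] := az _ _ _ (r_gt0 (n.*2.+1)).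
pose j := maxn N n.*2.+1.
have : ball (a k) (r n + r j + r n.*2.+1) z.
  apply: (@ball_triangle _ _ (a (m j))); first exact: gt.
  by apply/ball_sym/hN; rewrite /= leq_maxl.
apply: le_ball.
have rj : r j <= r n.*2.+1 by rewrite lef_pV2 ?posrE// ler_nat ltnS leq_maxr.
have -> : r n = r n.*2.+1 *+ 2.
  rewrite /r -[n.*2.+2]/(n.+1.*2).
  by rewrite -muln2 natrM invfM mulr2n -splitr.
move: rj; move: (r j) (r _) => x y; lra.
Qed.

Let decodeP (t : R) : good t -> near_named t (decode t).
Proof.
move=> gt; have [z zt] := near_named_lim gt.
by have [] := @xgetPex _ (a 0) [set z | good t /\ near_named t z] (ex_intro _ z (conj gt zt)).
Qed.

(** Distinct points would have disjoint balls around them, yet a center named at a small enough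
    radius lies in both. *)
Let near_named_uniq (t : R) z z' : good t -> near_named t z -> near_named t z' -> z = z'.
Proof.
move=> [/choice[m mt] gt] zt zt'; apply: contrapT => /eqP zz'.
move: hM; rewrite ball_hausdorff => /(_ _ _ zz')[[e e'] /= /eqP /seteqP[+ _]].
pose c : R := Num.min e%:num e'%:num / 2.
have c0 : 0 < c by rewrite divr_gt0// lt_min !gt0.
have [N hN] := natSinv_lt c0.
have [c1 c2] : r N *+ 2 <= e%:num /\ r N *+ 2 <= e'%:num.
  have : c *+ 2 <= e%:num /\ c *+ 2 <= e'%:num.
    by rewrite /c !mulr2n -splitr !ge_min !lexx/= orbT.
  by rewrite -/(r N) in hN; move: (r N) hN => x; lra.
move=> /(_ (a (m N))); apply; split; apply/ball_sym.
  exact: le_ball c1 _ (zt _ _ (mt N)).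
exact: le_ball c2 _ (zt' _ _ (mt N)).
Qed.

Let mdig n m : measurable [set t | dig n m t].
Proof. exact: measurable_digit. Qed.

Let mgood : measurable good.
Proof.
rewrite [good](_ : _ = (\bigcap_n \bigcup_m [set t | dig n m t]) `&`
  \bigcap_n \bigcap_m \bigcap_n' \bigcap_m'
    (~` ([set t | dig n m t] `&` [set t | dig n' m' t]) `|`
     [set _ | ball (a m) (r n + r n') (a m')])); last first.
  apply/seteqP; split=> t [h1 h2]; split.
  - by move=> n _; have [m] := h1 n; exists m.
  - move=> n _ m _ n' _ m' _; apply: contrapT => /not_orP[/contrapT [d1 d2]].
    by apply; exact: h2.
  - by move=> n; have [m _] := h1 n Logic.I; exists m.
  - move=> n m n' m' d1 d2.
    by have [h|//] := h2 n Logic.I m Logic.I n' Logic.I m' Logic.I; exfalso; apply: h.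
apply: measurableI.
  by apply: bigcapT_measurable => n; apply: bigcupT_measurable => m; exact: mdig.
do 4 (apply: bigcapT_measurable => ?).
apply: measurableU; last exact: measurable_cst_set.
by apply/measurableC/measurableI; exact: mdig.
Qed.

(** A good code is decoded into [O] exactly when some named ball, with doubled radius, is contained
    in [O]; this is a countable union of conditions on digits. *)
Let measurable_decode (O : set M) : open O -> measurable (decode @^-1` O).
Proof.
move=> oO.
rewrite [X in measurable X](_ : _ =
  (good `&` \bigcup_n \bigcup_m
     ([set t | dig n m t] `&` [set _ | ball (a m) (r n *+ 2) `<=` O])) `|`
  (~` good `&` [set _ | O (a 0)])).
  apply: measurableU; apply: measurableI => //; last 2 first.
  - exact: measurableC.
  - exact: measurable_cst_set.
  apply: bigcupT_measurable => n; apply: bigcupT_measurable => m.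
  by apply: measurableI; [exact: mdig|exact: measurable_cst_set].
have bad t : ~ good t -> decode t = a 0.
  by move=> gt; apply: xgetPN => z [].
apply/seteqP; split => t /=.
  move=> Ot; have [gt|gt] := pselect (good t); last first.
    by right; split => //; rewrite -(bad t gt).
  left; split => //.
  have := open_nbhs_nbhs (conj oO Ot); move=> /nbhs_ballP[e /= e0 eO].
  (* Two points of one doubled ball are within [4 * r n] of each other, so [r n < e / 4] keeps that
     ball inside [O]. *)
  have e40 : 0 < e / 4 by rewrite divr_gt0.
  have [n hn] := natSinv_lt e40; rewrite -/(r n) in hn.
  have [m mt] := gt.1 n; exists n => //; exists m => //; split => // w mw.
  apply: eO; apply: (@le_ball _ _ _ (r n *+ 2 + r n *+ 2)).
    by move: (r n) hn => x; lra.
  exact: ball_triangle (ball_sym (decodeP gt mt)) mw.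
move=> [[gt [n _ [m _ [/= mt]]]]|[gt]]; first by apply; exact: decodeP.
by rewrite bad.
Qed.

(** Interiors are named because a ball need not be open, while measurability will be known for
    preimages of open sets. *)
Let named (z : M) (i : nat) : bool :=
  if unpickle i is Some (n, m) then `[< ((ball (a m) (r n))° : set M) z >] else false.

Let dig_named n m z : dig n m (code R (named z)) = `[< ((ball (a m) (r n))° : set M) z >].
Proof. by rewrite /dig digit_code /named pickleK. Qed.

Let decodeK z : decode (code R (named z)) = z.
Proof.
have nz : near_named (code R (named z)) z.
  move=> n m; rewrite dig_named => /asboolP /interior_subset.
  by apply: le_ball; rewrite mulr2n lerDl ltW.
have gz : good (code R (named z)).
  split => [n|n m n' m'].
    (* Half the radius leaves room for a ball around [z] inside [ball (a m) (r n)], so that [z] is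
       an interior point. *)
    have r20 : 0 < r n / 2 by rewrite divr_gt0.
    have [m zm] := da z r20; exists m; rewrite dig_named; apply/asboolP.
    apply/nbhs_ballP; exists (r n / 2) => //= w zw.
    by have := ball_triangle (ball_sym zm) zw; rewrite -splitr.
  rewrite !dig_named => /asboolP /interior_subset h /asboolP /interior_subset h'.
  exact: ball_triangle h (ball_sym h').
exact: near_named_uniq gz (decodeP gz) nz.
Qed.

Lemma polish_retract d (Y : measurableType d) (f : Y -> M) :
  (forall O, open O -> measurable (f @^-1` O)) ->
  exists (s : Y -> R) (g : R -> M),
    [/\ measurable_fun setT s, forall y, 0 <= s y <= 3 / 2,
        forall O, open O -> measurable (g @^-1` O) & forall y, g (s y) = f y].
Proof.
move=> mf; exists (fun y => code R (named (f y))), decode; split => //.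
- apply: measurable_code => i; rewrite /named.
  case: (unpickle i) => [[n m]|]; last exact: measurable_cst_set.
  rewrite (_ : [set y | _] = f @^-1` (ball (a m) (r n))°); first exact/mf/open_interior.
  by apply/seteqP; split => y /=; [move/asboolP|move=> ?; apply/asboolP].
- by move=> y; exact: code_bound.
Qed.

End polish_retract.

Lemma standard_borel_retract (R : realType) d (Y : measurableType d) :
  standard_borel R Y ->
  exists (s : Y -> R) (g : R -> Y),
    [/\ measurable_fun setT s, forall y, 0 <= s y <= 3 / 2,
        measurable_fun setT g & forall y, g (s y) = y].
Proof.
move=> [M [f [hM [[D [cD dD]] [[f' fK f'K] mf]]]]].
have [a Da] : exists a : nat -> M, D `<=` range a.
  have /pfcard_geP[D0|[a]] := cD.
    by exists (fun=> f point); rewrite D0.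
  by exists a => z /(@surj _ _ _ _ a)[n _ <-]; exists n.
have da (z : M) (e : R) : 0 < e -> exists m, ball z e (a m).
  move=> e0; have [||w [zw /Da[m _ am]]] := dD (ball z e)°.
  - by exists z; apply: nbhsx_ballx.
  - exact: open_interior.
  - by exists m; rewrite am; exact: interior_subset zw.
have fO (O : set M) : open O -> measurable (f @^-1` O).
  by move=> oO; apply/mf; apply: sub_sigma_algebra.
have [s [g [ms s01 mg gs]]] := polish_retract hM da fO.
exists s, (f' \o g); split => //; last by move=> y /=; rewrite gs fK.
move=> _ B mB; rewrite setTI.
(* The sets with measurable preimage under [g] form a sigma-algebra containing the open sets, hence
   all Borel sets of [M]. *)
have : <<s [set O : set M | open O] >> `<=` [set C | measurable (g @^-1` C)].
  apply: smallest_sub; last by move=> O oO; exact: mg.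
  split.
  - by rewrite /= preimage_set0.
  - by move=> C mC; rewrite /= setTD preimage_setC; exact: measurableC.
  - by move=> F mF; rewrite /= preimage_bigcup; exact: bigcupT_measurable.
move=> /(_ (f' @^-1` B)); rewrite /= comp_preimage; apply.
apply/mf; rewrite -comp_preimage (_ : f' \o f = id)//.
by apply/funext => y /=; rewrite fK.
Qed.

(** * Kernels from distribution functions *)

Section cdf_kernel.
Context (R : realType) d (X : measurableType d) (F : X -> R -> R).
Hypothesis F_nd : forall x, nondecreasing (F x).
Hypothesis F_rc : forall x, right_continuous (F x).
Hypothesis F_0 : forall x (r : R), r < 0 -> F x r = 0.
Hypothesis F_1 : forall x (r : R), 2 <= r -> F x r = 1.
Hypothesis F_m : forall r, measurable_fun setT (F ^~ r).

HB.instance Definition _ x := isCumulative.Build R _ R (F x) (@F_nd x) (@F_rc x).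

Let F_Ny x : F x @ -oo --> (0:R).
Proof.
apply: cvg_near_cst; near=> r; apply: F_0; near: r.
exact: nbhs_ninfty_lt.
Unshelve. all: by end_near. Qed.

Let F_y x : F x @ +oo --> (1:R).
Proof.
apply: cvg_near_cst; near=> r; apply: F_1; near: r.
exact: nbhs_pinfty_ge.
Unshelve. all: by end_near. Qed.

HB.instance Definition _ x :=
  isCumulativeBounded.Build R 0 1 (F x) (@F_Ny x) (@F_y x).

Let K (x : X) : {measure set (measurableTypeR R) -> \bar R} :=
  lebesgue_stieltjes_measure (F x).

Let K_cdf x (r : R) : K x `]-oo, r]%classic = (F x r)%:E.
Proof. by rewrite -cdf_lebesgue_stieltjes_id /cdf /distribution /pushforward preimage_id. Qed.

Let KT x : K x setT = 1%E.
Proof. exact: (@probability_setT _ _ _ (lebesgue_stieltjes_measure (F x))). Qed.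

(** The sets on which [K] is measurable in [x] form a Dynkin class. Closed lower rays belong to it
    by [F_m], and their complements generate the Borel sets. *)
Let mK (C : set (measurableTypeR R)) : measurable C -> measurable_fun setT (K ^~ C).
Proof.
move=> mC; pose P := [set C : set (measurableTypeR R) | measurable_fun setT (K ^~ C)].
have PC (S : set (measurableTypeR R)) : measurable S -> P S -> P (~` S).
  move=> mS PS; rewrite /P /=.
  rewrite (_ : K ^~ _ = fun x => 1 - K x S)%E; first exact: emeasurable_funB.
  apply/funext => x; rewrite -setTD measureD ?setTI//; first by congr (_ - _)%E; exact: KT.
  by have : (K x setT < +oo)%E by rewrite KT ltry.
suff : P C by [].
apply: (@dynkin_induction _ (measurableTypeR R) (@RGenOInfty.G R) P) => //.
- exact: RGenOInfty.measurableE.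
- move=> _ _ [a ->] [b ->]; exists (Num.max a b).
  apply/seteqP; split => x /=; rewrite !in_itv/= !andbT gt_max.
    by case=> -> ->.
  by move/andP.
- by rewrite /P /=; under eq_fun do rewrite KT; exact: measurable_cst.
- move=> _ [r ->]; rewrite -setCitvl; apply: PC; first exact: measurable_itv.
  by rewrite /P /=; under eq_fun do rewrite K_cdf; exact/measurable_EFinP.
- move=> G mG tG PG; rewrite /P /=.
  under eq_fun do rewrite measure_bigcup//.
  apply: (@ge0_emeasurable_sum _ X R setT (fun i x => K x (G i)) (mem setT)).
    by move=> i x _ _; exact: measure_ge0.
  by move=> i _; exact: PG.
- by rewrite -[X in X C]RGenOInfty.measurableE.
Qed.

HB.instance Definition _ := isKernel.Build _ _ _ _ _ K mK.
HB.instance Definition _ := Kernel_isProbability.Build _ _ _ _ _ K KT.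

Lemma cdf_kernel : exists k : R.-pker X ~> measurableTypeR R,
  forall x (r : R), k x `]-oo, r]%classic = (F x r)%:E.
Proof. by exists K => x r; exact: K_cdf. Qed.

End cdf_kernel.

(** * L1 distance, and limits along fast sequences *)

Section l1_distance.
Context (R : realType) d (X : measurableType d) (p : probability X R).
Implicit Types u v w : X -> R.

Definition l1 u v : R := \int[p]_x `|u x - v x|.

Let p1 : p setT = 1%E. Proof. exact: probability_setT. Qed.

Lemma l1_sym u v : l1 u v = l1 v u.
Proof. by apply: eq_Rintegral => x _; rewrite distrC. Qed.

Lemma l1_tri v u w : bdm u -> bdm v -> bdm w -> l1 u w <= l1 u v + l1 v w.
Proof.
move=> bu bv bw; rewrite -bdm_intD//; try exact/bdm_norm/bdmB.
apply: bdm_le_int => //; [exact/bdm_norm/bdmB|by apply: bdmD; exact/bdm_norm/bdmB|].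
by move=> x; rewrite ler_distD.
Qed.

Lemma l1D u u' v v' : bdm u -> bdm u' -> bdm v -> bdm v' ->
  l1 (fun x => u x + u' x) (fun x => v x + v' x) <= l1 u v + l1 u' v'.
Proof.
move=> bu bu' bv bv'; rewrite -bdm_intD//; try exact/bdm_norm/bdmB.
apply: bdm_le_int => //.
- by apply/bdm_norm/bdmB; exact: bdmD.
- by apply: bdmD; exact/bdm_norm/bdmB.
- by move=> x; rewrite opprD addrACA ler_normD.
Qed.

Lemma l1_unitf u v : unitf u -> unitf v -> l1 u v <= \int[p]_x u x + \int[p]_x v x.
Proof.
move=> uu uv; have bu := unitf_bdm uu; have bv := unitf_bdm uv.
rewrite -bdm_intD//; apply: bdm_le_int => //; [exact/bdm_norm/bdmB|exact: bdmD|].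
move=> x; have := uu.2 x; have := uv.2 x => /andP[? ?] /andP[? ?].
by rewrite (le_trans (ler_normB _ _))// !ger0_norm.
Qed.

Lemma unitf_cvg0 (u : nat -> X -> R) (e : R) : (forall n, unitf (u n)) ->
  (forall x, u n x @[n --> \oo] --> 0) -> 0 < e -> exists n, \int[p]_x u n x < e.
Proof.
move=> uu u0 e0.
have : (\int[p]_x (u n x)%:E)%E @[n --> \oo] --> (\int[p]_x (cst 0 x))%E.
  apply: (@dominated_cvg _ _ _ _ _ measurableT _ _ (cst 1%E)) => //.
  - by move=> n; apply/measurable_EFinP; exact: (uu n).1.
  - by move=> x _; apply: cvg_EFin; [exact: nearW|exact: u0].
  - by apply: (@bdm_integrable _ _ _ p p1 (cst 1)); exact: bdm_cst.
  - move=> n x _; rewrite lee_fin.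
    by have /andP[? ?] := (uu n).2 x; rewrite ger0_norm.
rewrite integral0 => /fine_cvgP[_ /cvgrPdist_lt/(_ _ e0)[n _ /(_ n (leqnn n))]] /= h.
exists n; rewrite sub0r normrN in h.
exact: le_lt_trans (ler_norm _) h.
Qed.

End l1_distance.

Section kval_theory.
Context (R : realType) d1 d2 (X : measurableType d1) (Y : measurableType d2).
Variable k : R.-pker X ~> Y.

Lemma kvalU A B x : measurable A -> measurable B -> A `&` B = set0 ->
  kval k (A `|` B) x = kval k A x + kval k B x.
Proof.
move=> mA mB AB; apply: EFin_inj; rewrite EFinD !kvalK//; last exact: measurableU.
by rewrite measureU//; apply/eqP.
Qed.

Lemma kvalT x : kval k setT x = 1.
Proof. by rewrite /kval pker1. Qed.

Lemma kvalC A x : measurable A -> kval k (~` A) x = 1 - kval k A x.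
Proof.
move=> mA; rewrite -(kvalT x) -(setUv A) kvalU ?setICr//; last exact: measurableC.
by rewrite addrC addKr.
Qed.

Lemma le_kval A B x : measurable A -> measurable B -> A `<=` B -> kval k A x <= kval k B x.
Proof. by move=> mA mB AB; rewrite -lee_fin !kvalK// le_measure ?inE. Qed.

Lemma kval_cvg0 (C : nat -> set Y) x : (forall n, measurable (C n)) ->
  {homo C : n m / (n <= m)%N >-> m `<=` n} -> \bigcap_n C n = set0 ->
  kval k (C n) x @[n --> \oo] --> 0.
Proof.
move=> mC ndC C0; apply: fine_cvg.
have := @nonincreasing_cvg_mu _ _ _ (k x) C _ mC; rewrite C0 measure0; apply => //.
  by rewrite (le_lt_trans (kernel_le1 k x (mC 0%N)))// ltey.
by move=> n m nm; apply/subsetPset; exact: ndC.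
Qed.

End kval_theory.

Section limsup.
Context (R : realType).
Implicit Types u v : (\bar R)^nat.

Lemma limn_esup_ub u n c : (forall m, (n <= m)%N -> u m <= c)%E -> (limn_esup u <= c)%E.
Proof.
move=> uc; apply: (@le_trans _ _ (ereal_sup (u @` [set m | (n <= m)%N]))).
  by apply: ereal_inf_lbound; exists [set m | (n <= m)%N] => //; exists n.
by apply: ge_ereal_sup => _ [m /= nm <-]; exact: uc.
Qed.

Lemma limn_esup_lb u n c : (forall m, (n <= m)%N -> c <= u m)%E -> (c <= limn_esup u)%E.
Proof.
move=> cu; apply: le_ereal_inf_tmp => _ [A [N _ NA] <-].
apply: (@le_trans _ _ (u (maxn n N))); first by apply: cu; rewrite leq_maxl.
by apply: ereal_sup_ubound; exists (maxn n N) => //; apply: NA; rewrite /= leq_maxr.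
Qed.

Lemma le_limn_esup u v : (forall n, u n <= v n)%E -> (limn_esup u <= limn_esup v)%E.
Proof.
move=> uv; apply: le_ereal_inf_tmp => _ [A FA <-].
apply: (@le_trans _ _ (ereal_sup (u @` A))).
  by apply: ereal_inf_lbound; exists A.
apply: ge_ereal_sup => _ [m Am <-]; apply: (le_trans (uv m)).
by apply: ereal_sup_ubound; exists m.
Qed.

End limsup.

Section fast_limit.
Context (R : realType) d (X : measurableType d) (p : probability X R).
Variable v : nat -> X -> R.
Hypothesis uv : forall n, unitf (v n).

(** A limit superior is defined at every point and preserves pointwise inequalities, which an almost
    sure limit does only off a null set. *)
Definition limsupf (x : X) : R := fine (limn_esup (fun n => (v n x)%:E)).

Lemma limsupfE x : (limsupf x)%:E = limn_esup (fun n => (v n x)%:E).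
Proof.
rewrite /limsupf fineK// fin_real//; apply/andP; split.
  apply: (@lt_le_trans _ _ 0%E); first exact: ltNy0.
  by apply: (@limn_esup_lb _ _ 0) => n _; rewrite lee_fin; have /andP[] := (uv n).2 x.
apply: (@le_lt_trans _ _ 1%E); last exact: ltey.
by apply: (@limn_esup_ub _ _ 0) => n _; rewrite lee_fin; have /andP[] := (uv n).2 x.
Qed.

Lemma limsupf_ub x n c : (forall m, (n <= m)%N -> v m x <= c) -> limsupf x <= c.
Proof.
move=> h; rewrite -lee_fin limsupfE; apply: (@limn_esup_ub _ _ n) => m nm.
by rewrite lee_fin h.
Qed.

Lemma limsupf_lb x n c : (forall m, (n <= m)%N -> c <= v m x) -> c <= limsupf x.
Proof.
move=> h; rewrite -lee_fin limsupfE; apply: (@limn_esup_lb _ _ n) => m nm.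
by rewrite lee_fin h.
Qed.

Lemma unitf_limsupf : unitf limsupf.
Proof.
split.
  apply/measurable_EFinP.
  under [X in measurable_fun _ X]eq_fun do rewrite /= limsupfE.
  by apply: measurable_fun_limn_esup => n; apply/measurable_EFinP; exact: (uv n).1.
move=> x; apply/andP; split.
  by apply: (@limsupf_lb _ 0) => n _; have /andP[] := (uv n).2 x.
by apply: (@limsupf_ub _ 0) => n _; have /andP[] := (uv n).2 x.
Qed.

(* Pointwise, [v m] stays within the total variation of the tail, whose integral is a
   geometric series; no exceptional null set is needed. *)
Lemma limsupf_l1 n : (forall m, (n <= m)%N -> l1 p (v m.+1) (v m) <= 2^-1 ^+ m) ->
  l1 p limsupf (v n) <= 2 * 2^-1 ^+ n.
Proof.
move=> fast.
pose w k x := `|v (n + k).+1 x - v (n + k)%N x|.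
have bw k : bdm (w k) by apply/bdm_norm/bdmB; exact/unitf_bdm.
have p1 : p setT = 1%E by exact: probability_setT.
rewrite -lee_fin bdm_EFin//; last first.
  by apply/bdm_norm/bdmB; [exact/unitf_bdm/unitf_limsupf|exact/unitf_bdm].
apply: (@le_trans _ _ (\int[p]_x (\sum_(0 <= k <oo) (w k x)%:E))%E).
  apply: ge0_le_integral => //.
  - apply/measurable_EFinP; apply: measurableT_comp => //.
    by apply: measurable_funB; [exact: unitf_limsupf.1|exact: (uv n).1].
  - apply: (@ge0_emeasurable_sum _ X R setT (fun k x => (w k x)%:E) xpredT).
      by move=> k x _ _; rewrite lee_fin normr_ge0.
    move=> k _.
    by apply/measurable_EFinP; exact: (bw k).1.
  move=> x _.
  have w0 k : (0 <= (w k x)%:E)%E by rewrite lee_fin normr_ge0.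
  (* Where the total variation is infinite the bound is void; elsewhere its partial sums confine the
     whole tail of [v]. *)
  have [soo|] := eqVneq (\sum_(0 <= k <oo) (w k x)%:E)%E +oo%E; first by rewrite soo leey.
  set S := (\sum_(0 <= k <oo) _)%E => Soo.
  have Sfin : S \is a fin_num.
    by rewrite ge0_fin_numE ?lt_neqAle ?Soo ?leey//; exact: nneseries_ge0.
  have part m : `|v (n + m)%N x - v n x| <= fine S.
    apply: (@le_trans _ _ (\sum_(0 <= k < m) w k x)).
      elim: m => [|m ih]; first by rewrite addn0 subrr normr0 big_geq.
      rewrite big_nat_recr//= addnS (le_trans (ler_distD (v (n + m)%N x) _ _))//.
      by rewrite addrC lerD.
    rewrite -lee_fin fineK// -sumEFin.
    exact: nneseries_lim_ge.
  rewrite -(fineK Sfin) lee_fin ler_norml.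
  have lo : v n x - fine S <= limsupf x.
    apply: (@limsupf_lb _ n) => m nm; have := part (m - n)%N; rewrite subnKC//.
    by rewrite ler_norml => /andP[? ?]; lra.
  have hi : limsupf x <= v n x + fine S.
    apply: (@limsupf_ub _ n) => m nm; have := part (m - n)%N; rewrite subnKC//.
    by rewrite ler_norml => /andP[? ?]; lra.
  by apply/andP; split; lra.
rewrite integral_nneseries//; last 2 first.
- by move=> k; apply/measurable_EFinP; exact: (bw k).1.
- by move=> k x _; rewrite lee_fin normr_ge0.
apply: lime_le.
  by apply: is_cvg_nneseries => k _ _; apply: integral_ge0 => x _; rewrite lee_fin normr_ge0.
apply: nearW => m.
apply: (@le_trans _ _ (\sum_(0 <= k < m) (2^-1 ^+ (n + k) : R)%:E)%E).
  apply: lee_sum => k _; rewrite -bdm_EFin// lee_fin.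
  by apply: fast; exact: leq_addr.
rewrite sumEFin lee_fin.
have -> : \sum_(0 <= k < m) (2^-1 : R) ^+ (n + k) = 2 * (2^-1 ^+ n - 2^-1 ^+ (n + m)).
  elim: m => [|m ih]; first by rewrite big_geq// addn0 subrr mulr0.
  by rewrite big_nat_recr//= ih addnS exprS; field.
have : 0 <= (2^-1 : R) ^+ (n + m) by rewrite exprn_ge0// invr_ge0.
by move: (_ ^+ (n + m)) (_ ^+ n) => y z; lra.
Qed.

End fast_limit.

(** * Limits of nets of kernels into the line *)

Section net_limit.
Context (R : realType) d (X : measurableType d) (p : probability X R).
Context (L : Type) (le : L -> L -> Prop) (T : L -> R.-pker X ~> measurableTypeR R).
Let Z := measurableTypeR R.

Hypothesis dir : directed le.
Hypothesis T_supp0 : forall l x (r : R), r < 0 -> T l x `]-oo, r]%classic = 0%E.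
Hypothesis T_supp1 : forall l x (r : R), 2 <= r -> T l x `]-oo, r]%classic = 1%E.
Hypothesis T_marg : forall l l' (C : set Z), measurable C ->
  \int[p]_x kval (T l) C x = \int[p]_x kval (T l') C x.
Hypothesis T_cauchy : forall (C : set Z) (e : R), measurable C -> 0 < e ->
  exists l0, forall l, le l0 l -> l1 p (kval (T l) C) (kval (T l0) C) < e.

Let p1 : p setT = 1%E. Proof. exact: probability_setT. Qed.

Let bT l (C : set Z) : measurable C -> bdm (kval (T l) C).
Proof. by move=> mC; exact/unitf_bdm/unitf_kval. Qed.

Let ray (r : R) : set Z := `]-oo, r]%classic.
Let mray r : measurable (ray r). Proof. exact: measurable_itv. Qed.

Let rq (j : nat) : R := if unpickle j is Some q then ratr q else 0.

Let rqP (a b : R) : a < b -> exists j, a < rq j < b.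
Proof.
move=> /rat_in_itvoo[q]; rewrite in_itv/= => qab.
by exists (pickle q); rewrite /rq pickleK.
Qed.

(** Stability is stated for two arbitrary later indices, a form that survives enlarging [l0];
    directedness then merges the index for the last ray with the one found before. *)
Let common_index m (e : R) : 0 < e -> exists l0, forall j, (j < m)%N ->
  forall l l', le l0 l -> le l0 l' ->
    l1 p (kval (T l) (ray (rq j))) (kval (T l') (ray (rq j))) < e.
Proof.
move=> e0; elim: m => [|m [l0 h0]]; first by have [_ [_ [[l _] _]]] := dir; exists l.
have e20 : 0 < e / 2 by rewrite divr_gt0.
have [l1' h1] := T_cauchy (mray (rq m)) e20.
have [_ [tr [_ ub]]] := dir; have [l2 [l02 l12]] := ub l0 l1'.
exists l2 => j; rewrite ltnS leq_eqVlt => /predU1P[->|jm] l l' l2l l2l'; last first.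
  by apply: h0 => //; exact: tr l02 _.
have := h1 _ (tr _ _ _ l12 l2l); have := h1 _ (tr _ _ _ l12 l2l').
have := l1_tri p (bT l (mray (rq m))) (bT l1' (mray (rq m))) (bT l' (mray (rq m))).
rewrite [l1 p (kval (T l1') _) _]l1_sym.
by move: (l1 _ _ _) (l1 _ _ _) (l1 _ _ _) => a b c; lra.
Qed.

(** Stage [n] controls the rays of index at most [n], so each ray is controlled from some stage on.
    The bound concerns every [l] beyond [lam n] and not only the chain; this brings the net back
    from the sequence. *)
Let fast_chain : exists lam : nat -> L, forall n j l, (j <= n)%N -> le (lam n) l ->
  l1 p (kval (T l) (ray (rq j))) (kval (T (lam n)) (ray (rq j))) < 2^-1 ^+ n /\
  le (lam n) (lam n.+1).
Proof.
have h0 n : 0 < (2^-1 : R) ^+ n by rewrite exprn_gt0.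
have /choice[g hg] : forall n, exists l0, forall j, (j < n.+1)%N ->
  forall l l', le l0 l -> le l0 l' ->
    l1 p (kval (T l) (ray (rq j))) (kval (T l') (ray (rq j))) < 2^-1 ^+ n.
  by move=> n; exact: common_index.
have [rf [tr [_ ub]]] := dir.
have /choice[J hJ] : forall ab : L * L, exists c, le ab.1 c /\ le ab.2 c.
  by move=> [a b]; exact: ub.
pose lam := fix lam n := if n is m.+1 then J (lam m, g n) else g 0%N.
have glam n : le (g n) (lam n).
  by case: n => [|n]; [exact: rf|have [] := hJ (lam n, g n.+1)].
exists lam => n j l jn nl; split; last by have [] := hJ (lam n, g n.+1).
by apply: hg => //; exact: tr (glam n) _.
Qed.

Let converges (h : X -> R) (C : set Z) := forall e : R, 0 < e ->
  exists l0, forall l, le l0 l -> l1 p h (kval (T l) C) < e.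

Let convD (h h' : X -> R) (A B : set Z) : unitf h -> unitf h' -> measurable A ->
  measurable B -> A `&` B = set0 -> converges h A -> converges h' B ->
  converges (fun x => h x + h' x) (A `|` B).
Proof.
move=> uh uh' mA mB AB cA cB e e0; have e20 : 0 < e / 2 by rewrite divr_gt0.
have [a ha] := cA _ e20; have [b hb] := cB _ e20.
have [_ [tr [_ ub]]] := dir; have [c [ac bc]] := ub a b.
exists c => l cl.
rewrite (_ : kval _ _ = fun x => kval (T l) A x + kval (T l) B x); last first.
  by apply/funext => x; rewrite kvalU.
have := ha _ (tr _ _ _ ac cl); have := hb _ (tr _ _ _ bc cl).
have := l1D p (unitf_bdm uh) (unitf_bdm uh') (bT l mA) (bT l mB).
by move: (l1 _ _ _) (l1 _ _ _) (l1 _ _ _) => x y z; lra.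
Qed.

Let convC h A : unitf h -> measurable A -> converges h A ->
  converges (fun x => 1 - h x) (~` A).
Proof.
move=> uh mA cA e e0; have [a ha] := cA _ e0; exists a => l al.
rewrite (_ : l1 _ _ _ = l1 p h (kval (T l) A)); first exact: ha.
apply: eq_Rintegral => x _; rewrite kvalC// -normrN; congr (`|_|); lra.
Qed.

Let lam := projT1 (cid fast_chain).
Let lamP := projT2 (cid fast_chain).

Let v j n := kval (T (lam n)) (ray (rq j)).
Let uv j n : unitf (v j n). Proof. exact: unitf_kval. Qed.
Let G j := limsupf (v j).
Let uG j : unitf (G j). Proof. exact: unitf_limsupf. Qed.

Let pow_small (e : R) : 0 < e -> exists N, forall n, (N <= n)%N -> 2^-1 ^+ n < e.
Proof.
move=> e0; have [N _ hN] := near_infty_natSinv_expn_lt (PosNum e0).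
by exists N => n Nn; have := hN n Nn; rewrite /= div1r exprVn.
Qed.

Let lam_refl n : le (lam n) (lam n). Proof. exact: dir.1. Qed.

Let G_conv j : converges (G j) (ray (rq j)).
Proof.
(* From the limit superior to stage [n] the cost is twice [2^-1 ^+ n], and from stage [n] to [l]
   once more: three thirds in all. *)
move=> e e0; have e30 : 0 < e / 3 by rewrite divr_gt0.
have [N hN] := pow_small e30; pose n := maxn N j.
have jn : (j <= n)%N by rewrite leq_maxr.
exists (lam n) => l nl.
have h1 : l1 p (G j) (v j n) <= 2 * 2^-1 ^+ n.
  apply: limsupf_l1 => // m nm; have jm := leq_trans jn nm.
  have [_ mm] := lamP jm (lam_refl m).
  by have [/ltW] := lamP jm mm.
have [h2 _] := lamP jn nl; rewrite l1_sym in h2.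
have := l1_tri p (unitf_bdm (uG j)) (unitf_bdm (uv j n)) (bT l (mray (rq j))).
have := hN n (leq_maxl _ _).
move: h1 h2; move: (l1 _ _ _) (l1 _ _ _) (l1 _ _ _) (_ ^+ n) => x y z w; lra.
Qed.

(** The limit superior inherits the inequality from the kernels at every [x], so no null set is
    discarded on the way to a distribution function. *)
Let G_mono i j x : rq i <= rq j -> G i x <= G j x.
Proof.
move=> ij; rewrite -lee_fin /G !limsupfE//; apply: le_limn_esup => n.
rewrite lee_fin; apply: le_kval => //.
by apply: subset_itvl; rewrite bnd_simp.
Qed.

Let G_0 j x : rq j < 0 -> G j x = 0.
Proof.
move=> j0; apply/le_anti/andP; split; last by have /andP[] := (uG j).2 x.
apply: (@limsupf_ub _ _ _ _ (uv j) x 0%N) => m _.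
by rewrite /v /kval T_supp0.
Qed.

Let G_1 j x : 2 <= rq j -> G j x = 1.
Proof.
move=> j0; apply/le_anti/andP; split; first by have /andP[] := (uG j).2 x.
apply: (@limsupf_lb _ _ _ _ (uv j) x 0%N) => m _.
by rewrite /v /kval T_supp1.
Qed.

(** The value 1 is neutral in an infimum, since [G] is at most 1; so the infimum over all [j] is the
    one over the rationals strictly above [r]. Strictness is what makes [F] right-continuous. *)
Let H (r : R) j x : R := if r < rq j then G j x else 1.

Let H01 r j x : 0 <= H r j x <= 1.
Proof. by rewrite /H; case: ifP => _; [exact: (uG j).2|rewrite ler01 lexx]. Qed.

Let F x r := inf (range (fun j => H r j x)).

Let H_lb r x : has_lbound (range (fun j => H r j x)).
Proof. by exists 0 => _ [j _ <-]; have /andP[] := H01 r j x. Qed.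

Let H_inf r x : has_inf (range (fun j => H r j x)).
Proof. by split; [exists (H r 0%N x); exists 0%N|exact: H_lb]. Qed.

Let F_le j r x : r < rq j -> F x r <= G j x.
Proof. by move=> rj; apply: ge_inf; [exact: H_lb|exists j => //; rewrite /H rj]. Qed.

Let F_ge c r x : c <= 1 -> (forall j, r < rq j -> c <= G j x) -> c <= F x r.
Proof.
move=> c1 cG; apply: lb_le_inf; first exact: (H_inf r x).1.
by move=> _ [j _ <-]; rewrite /H; case: ifPn => // /cG.
Qed.

Let F_adh (e : R) r x : 0 < e -> exists j, r < rq j /\ G j x < F x r + e.
Proof.
move=> e0; have [_ [j _ <-]] := inf_adherent e0 (H_inf r x); rewrite -/(F x r) /H.
case: ifPn => [rj h|_ h]; first by exists j.
have [i /andP[ri _]] : exists i, r < rq i < r + 1 by apply: rqP; rewrite ltrDl.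
by exists i; split => //; apply: le_lt_trans h; have /andP[] := (uG i).2 x.
Qed.

Let F01 x r : 0 <= F x r <= 1.
Proof.
apply/andP; split.
  by apply: F_ge => // j _; have /andP[] := (uG j).2 x.
apply: (@le_trans _ _ (H r 0%N x)); last by have /andP[] := H01 r 0%N x.
by apply: ge_inf; [exact: H_lb|exists 0%N].
Qed.

Let F_nd x : nondecreasing (F x).
Proof.
move=> r s rs; apply: F_ge; first by have /andP[] := F01 x r.
by move=> j sj; apply: F_le; exact: le_lt_trans sj.
Qed.

Let F_rc x : right_continuous (F x).
Proof.
move=> r; apply/cvgrPdist_lt => e e0.
have [j [rj Gj]] := F_adh r x e0.
near=> t.
have rt : r <= t by near: t; exact: nbhs_right_ge.
have tj : t < rq j by near: t; exact: nbhs_right_lt.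
have := F_le x tj; have := F_nd x rt.
by rewrite distrC ltr_norml => ? ?; apply/andP; split; lra.
Unshelve. all: by end_near. Qed.

Let F_0 x r : r < 0 -> F x r = 0.
Proof.
move=> r0; have [j /andP[rj j0]] := rqP r0.
apply/le_anti/andP; split; last by have /andP[] := F01 x r.
by rewrite -(G_0 x j0); exact: F_le.
Qed.

Let F_1 x r : 2 <= r -> F x r = 1.
Proof.
move=> r2; apply/le_anti/andP; split; first by have /andP[] := F01 x r.
by apply: F_ge => // j rj; rewrite G_1//; exact/ltW/(le_lt_trans r2).
Qed.

Let F_m r : measurable_fun setT (F ^~ r).
Proof.
rewrite (_ : F ^~ r = fun x => infs (fun j => H r j x) 0%N).
  apply: measurable_fun_infs; first by move=> x _; exact: H_lb.
  by move=> j; rewrite /H; case: (r < rq j); [exact: (uG j).1|exact: measurable_cst].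
apply/funext => x; rewrite /F /infs /= /sdrop; congr inf.
by apply/seteqP; split => [_ [j _ <-]|_ [j _ <-]]; exists j.
Qed.

(** A rational [q n] slightly above [r] links both sides. Replacing [F] by [G] costs little by
    [F_adh]; shortening the ray from [q n] to [r] costs the mass of a short interval, whose average
    does not depend on the index by [T_marg]. *)
Let F_conv r : converges (F ^~ r) (ray r).
Proof.
move=> e e0; have [_ [_ [[l0 _] _]]] := dir.
have /choice[q hq] : forall n : nat, exists j, r < rq j < r + n.+1%:R^-1.
  by move=> n; apply: rqP; rewrite ltrDl invr_gt0.
pose C n : set Z := `]r, r + n.+1%:R^-1]%classic.
have mC n : measurable (C n) by exact: measurable_itv.
have uF s : unitf (F ^~ s) by split; [exact: F_m|move=> x; exact: F01].
(* Both errors go into one function, so that one [n] serves both; the factor 1/2 keeps it in the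
   unit interval. *)
pose w n x := 2^-1 * ((G (q n) x - F x r) + kval (T l0) (C n) x).
have GF n x : 0 <= G (q n) x - F x r.
  by rewrite subr_ge0 F_le//; have /andP[] := hq n.
have uw n : unitf (w n).
  split.
    apply: measurable_funM => //; apply: measurable_funD; last exact: (unitf_kval _ (mC n)).1.
    by apply: measurable_funB; [exact: (uG _).1|exact: F_m].
  move=> x; have := GF n x; have := (uG (q n)).2 x; have := F01 x r.
  have := (unitf_kval (T l0) (mC n)).2 x; rewrite /w.
  by move: (G _ _) (F _ _) (kval _ _ _) => ? ? ? /andP[? ?] /andP[? ?] /andP[? ?] ?;
    apply/andP; split; lra.
have w0 x : w n x @[n --> \oo] --> 0.
  rewrite -[X in _ --> X](mulr0 2^-1) -[X in _ * X](addr0 0).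
  apply: cvgM; first exact: cvg_cst.
  apply: cvgD; last first.
    apply: kval_cvg0 => //.
    - move=> n m nm; apply: subset_itvl; rewrite bnd_simp lerD2l.
      by rewrite lef_pV2 ?posrE// ler_nat ltnS.
    - rewrite -subset0 => y; rewrite /bigcap /= => h.
      have /andP[ry _] : (r < y) && (y <= r + 1%:R^-1).
        by have := h 0%N Logic.I; rewrite /C /= in_itv.
      have yr0 : 0 < (y : R) - r by rewrite subr_gt0.
      have [n hn] := natSinv_lt yr0.
      have := h n Logic.I; rewrite /C /= in_itv/= => /andP[_ yn].
      by move: hn yn; move: (_^-1) => z; lra.
  apply/cvgrPdist_lt => c c0.
  have [j [rj Gj]] := F_adh r x c0.
  have jr0 : 0 < rq j - r by rewrite subr_gt0.
  have [N hN] := natSinv_lt jr0.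
  exists N => // n /= Nn; rewrite sub0r normrN ger0_norm//.
  have : G (q n) x <= G j x.
    apply: G_mono; have /andP[_ /ltW qn] := hq n.
    apply: (le_trans qn); rewrite -lerBrDl; apply: le_trans (ltW hN).
    by rewrite lef_pV2 ?posrE// ler_nat ltnS.
  lra.
(* Integral of [w] below [e / 8] bounds the two errors together by [e / 4], and [G_conv] adds
   [e / 8]. *)
have e80 : 0 < e / 8 by rewrite divr_gt0.
have [n wn] := unitf_cvg0 p uw w0 e80.
have [l0' hG] := G_conv (q n) e80.
exists l0' => l ll.
have bG := unitf_bdm (uG (q n)).
have bF := unitf_bdm (uF r).
have := hG _ ll.
have := l1_tri p bF bG (bT l (mray r)).
have := l1_tri p bG (bT l (mray (rq (q n)))) (bT l (mray r)).
have /andP[rqn /ltW qnr] := hq n.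
have h3 : l1 p (kval (T l) (ray (rq (q n)))) (kval (T l) (ray r)) <= \int[p]_x kval (T l0) (C n) x.
  (* The bound is secured for the fixed [l0]; equality of marginals moves it to the arbitrary
     [l]. *)
  rewrite (T_marg l0 l (mC n)); apply: bdm_le_int => //; [|exact: bT|].
    by apply/bdm_norm/bdmB; exact: bT.
  move=> x.
  have mI : measurable (`]r, rq (q n)]%classic : set Z) by exact: measurable_itv.
  have -> : ray (rq (q n)) = ray r `|` (`]r, rq (q n)]%classic : set Z).
    by rewrite /ray -itv_bndbnd_setU// bnd_simp// ltW.
  rewrite kvalU//; last first.
    rewrite -subset0 => y [] /=; rewrite !in_itv/= => yr /andP[ry _].
    by have := lt_le_trans ry yr; rewrite ltxx.
  rewrite addrAC subrr add0r ger0_norm; last by have /andP[] := (unitf_kval (T l) mI).2 x.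
  by apply: le_kval => //; apply: subset_itvl; rewrite bnd_simp.
have h1 : l1 p (F ^~ r) (G (q n)) = \int[p]_x (G (q n) x - F x r).
  by apply: eq_Rintegral => x _; rewrite distrC ger0_norm.
have h2 : \int[p]_x w n x =
    2^-1 * (\int[p]_x (G (q n) x - F x r) + \int[p]_x kval (T l0) (C n) x).
  rewrite bdm_intZ//; last by apply: bdmD; [exact: bdmB|exact: bT].
  by rewrite bdm_intD//; [exact: bdmB|exact: bT].
have h4 : 0 <= \int[p]_x kval (T l0) (C n) x.
  by apply: Rintegral_ge0 => x _; have /andP[] := (unitf_kval (T l0) (mC n)).2 x.
have h5 : 0 <= \int[p]_x (G (q n) x - F x r) by apply: Rintegral_ge0 => x _; exact: GF.
move: h3 h1 h2 h4 h5 wn.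
move: (l1 _ _ _) (l1 _ _ _) (l1 _ _ _) (l1 _ _ _) (l1 _ _ _).
move: (Rintegral _ _ _) (Rintegral _ _ _) (Rintegral _ _ _) => a1 a2 a3 b1 b2 b3 b4 b5; lra.
Qed.

Lemma net_limit : exists K : R.-pker X ~> measurableTypeR R,
  forall C : set (measurableTypeR R), measurable C ->
  forall e : R, 0 < e -> exists l0, forall l, le l0 l ->
    l1 p (kval K C) (kval (T l) C) < e.
Proof.
have [K KF] := cdf_kernel F_nd F_rc F_0 F_1 F_m.
exists K => C mC; rewrite -/(converges _ _).
pose P := [set C : set Z | converges (kval K C) C].
have PC (S : set Z) : measurable S -> P S -> P (~` S).
  move=> mS PS; rewrite /P /=.
  rewrite (_ : kval K _ = fun x => 1 - kval K S x); first by apply: convC => //; exact: unitf_kval.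
  by apply/funext => x; rewrite kvalC.
suff : P C by [].
apply: (@dynkin_induction _ Z (@RGenOInfty.G R) P) => //.
- exact: RGenOInfty.measurableE.
- move=> _ _ [a ->] [b ->]; exists (Num.max a b).
  apply/seteqP; split => x /=; rewrite !in_itv/= !andbT gt_max.
    by case=> -> ->.
  by move/andP.
- move=> e e0; have [_ [_ [[l _] _]]] := dir; exists l => l' _.
  rewrite (_ : l1 _ _ _ = 0)// /l1; under eq_Rintegral do rewrite !kvalT subrr normr0.
  exact: bdm_int_cst.
- move=> _ [r ->]; rewrite -setCitvl; apply: PC; first exact: measurable_itv.
  rewrite /P /= (_ : kval K _ = F ^~ r); first exact: F_conv.
  by apply/funext => x; rewrite /kval KF.
(* Finite unions converge by [convD]. The tail [W n] shrinks for [K] and for [T l0] by continuity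
   from above, and [T_marg] makes it small on average for all [T l] at once. *)
- move=> D mD tD PD e e0.
  pose U n := \big[setU/set0]_(i < n) D i.
  have mU n : measurable (U n) by exact: bigsetU_measurable.
  have UD n : U n `&` D n = set0.
    rewrite /U -bigcup_mkord setI_bigcupl; apply: bigcup0 => i /= ni.
    by move/trivIsetP : tD; apply => //; rewrite neq_ltn ni.
  have PU n : P (U n).
    elim: n => [|n ih].
      move=> c c0; have [_ [_ [[l _] _]]] := dir; exists l => l' _.
      rewrite (_ : l1 _ _ _ = 0)// /l1.
      under eq_Rintegral do rewrite /U big_ord0 /kval !measure0 subrr normr0.
      exact: bdm_int_cst.
    have -> : U n.+1 = U n `|` D n by rewrite /U big_ord_recr.
    rewrite /P /= (_ : kval K _ = fun x => kval K (U n) x + kval K (D n) x).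
      by apply: convD => //; [exact: unitf_kval|exact: unitf_kval|exact: PD].
    by apply/funext => x; rewrite kvalU.
  pose S := \bigcup_k D k.
  have mS : measurable S by exact: bigcupT_measurable.
  pose W n := S `\` U n.
  have mW n : measurable (W n) by exact: measurableD.
  have US n : U n `|` W n = S.
    by rewrite /W setDUK// /U -bigcup_mkord => y [i _ Di]; exists i.
  have UW n : U n `&` W n = set0 by rewrite /W setDE setIC -setIA setICl setI0.
  have [_ [_ [[l0 _] _]]] := dir.
  pose w n x := 2^-1 * (kval K (W n) x + kval (T l0) (W n) x).
  have uK n := unitf_kval K (mW n).
  have uT l n := unitf_kval (T l) (mW n).
  have uw n : unitf (w n).
    split.
      by apply: measurable_funM => //; apply: measurable_funD; [exact: (uK n).1|exact: (uT l0 n).1].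
    move=> x; have := (uK n).2 x; have := (uT l0 n).2 x; rewrite /w.
    by move: (kval _ _ _) (kval _ _ _) => ? ? /andP[? ?] /andP[? ?]; apply/andP; split; lra.
  have ndW : {homo W : n m / (n <= m)%N >-> m `<=` n}.
    move=> n m nm; apply: setDS; rewrite /U -!bigcup_mkord.
    by apply: bigcup_sub => i /= ni; apply: bigcup_sup => /=; exact: leq_trans nm.
  have W0 : \bigcap_n W n = set0.
    rewrite -subset0 => y h; have [[i _ Di] _] := h 0%N Logic.I.
    have [_] := h i.+1 Logic.I; apply; rewrite /U -bigcup_mkord.
    by exists i => /=.
  have w0 x : w n x @[n --> \oo] --> 0.
    rewrite -[X in _ --> X](mulr0 2^-1) -[X in _ * X](addr0 0).
    apply: cvgM; first exact: cvg_cst.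
    by apply: cvgD; exact: kval_cvg0.
  (* As [w] is half a sum, [e / 4] for it means [e / 2] for the two tails; the finite union takes
     the other half. *)
  have e40 : 0 < e / 4 by rewrite divr_gt0.
  have e20 : 0 < e / 2 by rewrite divr_gt0.
  have [n wn] := unitf_cvg0 p uw w0 e40.
  have [l1' hU] := PU n _ e20; exists l1' => l ll; have := hU _ ll.
  have -> : kval K S = fun x => kval K (U n) x + kval K (W n) x.
    by apply/funext => x; rewrite -kvalU// US.
  have -> : kval (T l) S = fun x => kval (T l) (U n) x + kval (T l) (W n) x.
    by apply/funext => x; rewrite -kvalU// US.
  have bK (A : set Z) : measurable A -> bdm (kval K A) by move=> mA; exact/unitf_bdm/unitf_kval.
  have := l1D p (bK _ (mU n)) (bK _ (mW n)) (bT l (mU n)) (bT l (mW n)).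
  have := l1_unitf p (uK n) (uT l n); rewrite (T_marg l l0 (mW n)).
  have : \int[p]_x w n x =
      2^-1 * (\int[p]_x kval K (W n) x + \int[p]_x kval (T l0) (W n) x).
    rewrite bdm_intZ//; last by apply: bdmD; [exact: bK|exact: bT].
    by rewrite bdm_intD//; [exact: bK|exact: bT].
  move: wn; move: (l1 _ _ _) (l1 _ _ _) (l1 _ _ _).
  by move: (Rintegral _ _ _) (Rintegral _ _ _) (Rintegral _ _ _) => a1 a2 a3 b1 b2 b3; lra.
- by rewrite -[X in X C]RGenOInfty.measurableE.
Qed.

End net_limit.

(** * Dagger idempotents as orthogonal projections *)

Section idempotents.
Context (R : realType) d (X : measurableType d) (p : probability X R).
Implicit Types (e f k h : R.-pker X ~> X).

Let p1 : p setT = 1%E. Proof. exact: probability_setT. Qed.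

(** Being about integrals only, this form of [e = e^+] involves no choice of Bayesian inverse and no
    null set. *)
Definition selfadj e := forall A B, measurable A -> measurable B ->
  \int[p]_x (\1_A x * kval e B x) = \int[p]_x (\1_B x * kval e A x).

(** For self-adjoint [e], the instance [below e e] is idempotence. *)
Definition below e f := forall A B, measurable A -> measurable B ->
  \int[p]_x (kval e A x * kval f B x) = \int[p]_x (\1_A x * kval e B x).

Lemma int_kval k A B : measurable A -> measurable B ->
  (\int[p]_(x in A) k x B)%E = (\int[p]_x (\1_A x * kval k B x))%:E.
Proof.
move=> mA mB; rewrite -int_mul_indic//; last exact/unitf_bdm/unitf_kval.
by apply: eq_integral => x _; rewrite kvalK.
Qed.

Lemma bayes_invE k h : bayes_inv p p k h -> forall A B, measurable A -> measurable B ->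
  \int[p]_x (\1_A x * kval k B x) = \int[p]_x (\1_B x * kval h A x).
Proof. by move=> [_ kh] A B mA mB; apply: EFin_inj; rewrite -!int_kval// kh. Qed.

Lemma unitf_indM A u : measurable A -> unitf u -> unitf (fun x : X => \1_A x * u x : R).
Proof. by move=> mA uu; apply: unitfM => //; exact: unitf_indic. Qed.

Lemma kae_eq_int (k h : X -> set X -> \bar R) A B : measurable A -> measurable B ->
  unitf (fun x => fine (k x B)) -> unitf (fun x => fine (h x B)) -> kae_eq p k h ->
  \int[p]_x (\1_A x * fine (k x B)) = \int[p]_x (\1_A x * fine (h x B)).
Proof.
move=> mA mB uk uh /(_ B mB) kh.
apply: bdm_ae_int => //; try exact/unitf_bdm/unitf_indM.
by apply: filterS kh => x ->.
Qed.

Lemma dagger_selfadj e : dagger_idem p e -> selfadj e.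
Proof.
move=> [_ [_ [e' [/bayes_invE ee' e'e]]]] A B mA mB; rewrite ee'//.
exact: (@kae_eq_int (fun x B => e' x B) (fun x B => e x B) B A mB mA
  (unitf_kval e' mA) (unitf_kval e mA) e'e).
Qed.

(** Both sides are averaging in [u], so one of the two indicators in [selfadj] may become any
    function into the unit interval. *)
Lemma selfadj_kop e B u : selfadj e -> measurable B -> unitf u ->
  \int[p]_x (\1_B x * kop e u x) = \int[p]_x (u x * kval e B x).
Proof.
move=> se mB uu.
apply: (averaging_eq (averaging_kop e p1 (unitf_indic R mB))
                     (averaging_mul p1 (unitf_kval e mB))) => // C mC.
by under eq_Rintegral do rewrite kop_indic//; exact: se.
Qed.

Lemma kcompose_kop f e B x : measurable B -> kcompose f e x B = (kop e (kval f B) x)%:E.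
Proof.
move=> mB; rewrite kop_EFin; last exact: unitf_kval.
by apply: eq_integral => y _; rewrite kvalK.
Qed.

(** Self-adjointness moves [e] from the composite onto the test indicator, and integrals against all
    indicators determine a function almost surely. *)
Lemma kcompose_aeP f e k : selfadj e -> kae_eq p (kcompose f e) (fun x B => k x B) <->
  forall A B, measurable A -> measurable B ->
    \int[p]_x (kval e A x * kval f B x) = \int[p]_x (\1_A x * kval k B x).
Proof.
move=> se; have uk B := unitf_kval k (B := B).
have uo B : measurable B -> unitf (kop e (kval f B)).
  by move=> mB; exact/unitf_kop/unitf_kval.
have -> : (forall A B, measurable A -> measurable B ->
    \int[p]_x (kval e A x * kval f B x) = \int[p]_x (\1_A x * kval k B x)) <->
  (forall A B, measurable A -> measurable B ->
    \int[p]_x (\1_A x * kop e (kval f B) x) = \int[p]_x (\1_A x * kval k B x)).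
  split=> h A B mA mB; rewrite -h//.
    rewrite selfadj_kop//; last exact: unitf_kval.
    by under eq_Rintegral do rewrite mulrC.
  rewrite selfadj_kop//; last exact: unitf_kval.
  by under eq_Rintegral do rewrite mulrC.
split=> [fek A B mA mB|h B mB].
  have := kae_eq_int mA mB _ (uk B mB) fek.
  rewrite (_ : (fun x => fine (kcompose f e x B)) = kop e (kval f B)).
    by move=> /(_ (uo B mB)) <-; apply: eq_Rintegral => x _; rewrite kcompose_kop.
  by apply/funext => x; rewrite kcompose_kop.
have := bdm_ae_eq p1 (unitf_bdm (uo B mB)) (unitf_bdm (uk B mB)) (fun A mA => h A B mA mB).
by apply: filterS => x; rewrite kcompose_kop// => ->; rewrite kvalK.
Qed.

(** The two equations in [idem_le] are adjoint to each other: exchanging [A] and [B] turns one into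
    the other. *)
Lemma idem_leP e f : selfadj e -> selfadj f -> idem_le p e f <-> below e f.
Proof.
move=> se sf; rewrite /idem_le (kcompose_aeP e e sf) (kcompose_aeP f e se).
split=> [[]//|h]; split=> // A B mA mB.
by under eq_Rintegral do rewrite mulrC; rewrite h// se.
Qed.

Lemma selfadj_meas_pres e : selfadj e -> meas_pres p p e.
Proof.
move=> se B mB; rewrite int_kval// se//.
rewrite (_ : \int[p]_x _ = \int[p]_x \1_B x).
  rewrite int_indic// fineK//; exact: fin_num_measure.
by apply: eq_Rintegral => x _; rewrite kvalT mulr1.
Qed.

Lemma selfadj_bayes_inv e : selfadj e -> bayes_inv p p e e.
Proof.
move=> se; split; first exact: selfadj_meas_pres.
by move=> A B mA mB; rewrite !int_kval// se.
Qed.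

Lemma dagger_idemP e : dagger_idem p e <-> selfadj e /\ below e e.
Proof.
split=> [de|[se bee]].
  have se := dagger_selfadj de; split => //; apply/(idem_leP se se).
  by case: de => _ [].
split; first exact: selfadj_meas_pres.
have [ee _] := (idem_leP se se).2 bee.
by split => //; exists e; split; [exact: selfadj_bayes_inv|move=> B mB; exact: aeW].
Qed.

(** Both functions have the same integrals against every indicator. This reduces the two-sided
    topology to the one-sided one. *)
Lemma bayes_inv_ae e h B : selfadj e -> bayes_inv p p e h -> measurable B ->
  {ae p, forall x, kval h B x = kval e B x}.
Proof.
move=> se /bayes_invE eh mB; apply: bdm_ae_eq => //; try exact/unitf_bdm/unitf_kval.
by move=> A mA; rewrite -eh// se.
Qed.

Lemma meas_pres_kop e u : meas_pres p p e -> unitf u ->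
  \int[p]_x kop e u x = \int[p]_x u x.
Proof.
move=> mpe uu; have u1 : unitf (cst 1 : X -> R) by apply: unitf_cst; rewrite ler01 lexx.
have := averaging_eq (averaging_kop e p1 u1) (averaging_int p1) _ uu.
under [X in (_ -> X = _) -> _]eq_Rintegral do rewrite mul1r.
apply => C mC; rewrite kop_indic//; under eq_Rintegral do rewrite mul1r.
apply: EFin_inj; transitivity (p C); last first.
  by rewrite int_indic// fineK// fin_num_measure.
rewrite bdm_EFin//; last exact/unitf_bdm/unitf_kval.
by rewrite -[RHS]mpe//; apply: eq_integral => x _; rewrite kvalK.
Qed.

(** For a projection this is the squared norm of the image of [\1_B], a bounded real quantity that
    is monotone in [e]. *)
Definition diag e B := \int[p]_x (\1_B x * kval e B x).

Lemma diag01 e B : measurable B -> 0 <= diag e B <= 1.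
Proof. by move=> mB; apply: unitf_int01 => //; apply: unitf_indM => //; exact: unitf_kval. Qed.

(** In the expanded square, the mixed product and the square of [e] both integrate to [diag e B]. *)
Lemma below_sqdist e f B : measurable B -> below e e -> below f f -> below e f ->
  \int[p]_x (kval f B x - kval e B x) ^+ 2 = diag f B - diag e B.
Proof.
move=> mB ee ff ef; rewrite /diag.
have bk k : bdm (kval k B) by exact/unitf_bdm/unitf_kval.
have -> : \int[p]_x (kval f B x - kval e B x) ^+ 2 =
    \int[p]_x (kval f B x * kval f B x + kval e B x * kval e B x
       - 2 * (kval e B x * kval f B x)).
  by apply: eq_Rintegral => x _; ring.
rewrite bdm_intB ?bdm_intD ?bdm_intZ ?ee ?ff ?ef//; try exact: bdmM.
- by ring.
- by apply: bdmD; exact: bdmM.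
- exact/bdmZ/bdmM.
Qed.

Lemma below_le e f B : measurable B -> below e e -> below f f -> below e f ->
  diag e B <= diag f B.
Proof.
move=> mB ee ff ef; rewrite -subr_ge0 -below_sqdist//.
by apply: Rintegral_ge0 => x _; rewrite sqr_ge0.
Qed.

Lemma below_l1 e f B (c : R) : measurable B -> below e e -> below f f -> below e f ->
  0 < c -> diag f B - diag e B < c ^+ 2 -> l1 p (kval f B) (kval e B) < c.
Proof.
move=> mB ee ff ef c0; rewrite -below_sqdist// => hc.
have bd : bdm (fun x => kval f B x - kval e B x).
  by apply: bdmB; exact/unitf_bdm/unitf_kval.
have b2 : bdm (fun x => (kval f B x - kval e B x) ^+ 2) by exact: bdmM.
(* AM-GM: [|z| <= c / 2 + z^2 / (2 c)] *)
have : l1 p (kval f B) (kval e B) <=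
    c / 2 + (2 * c)^-1 * \int[p]_x (kval f B x - kval e B x) ^+ 2.
  rewrite -bdm_intZ// -[X in X + _](bdm_int_cst p1) -bdm_intD//; [|exact: bdm_cst|exact: bdmZ].
  apply: bdm_le_int => //; first exact: bdm_norm.
    by apply: bdmD; [exact: bdm_cst|exact: bdmZ].
  move=> x; rewrite -[in leRHS]real_normK ?num_real//; move: `|_| => z.
  rewrite -subr_ge0 (_ : _ - z = (2 * c)^-1 * (z - c) ^+ 2); last by field; rewrite gt_eqF.
  by rewrite mulr_ge0 ?sqr_ge0// invr_ge0 mulr_ge0// ltW.
move=> /le_lt_trans; apply.
have : (2 * c)^-1 * \int[p]_x (kval f B x - kval e B x) ^+ 2 < (2 * c)^-1 * c ^+ 2.
  by rewrite ltr_pM2l// invr_gt0 mulr_gt0.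
have -> : (2 * c)^-1 * c ^+ 2 = c / 2 by field; rewrite gt_eqF.
by move: (_ * _) => z; lra.
Qed.

End idempotents.

(** * Nets of reals and of kernels *)

Section nets.
Context (R : realType) (L : Type) (le : L -> L -> Prop).
Hypothesis dir : directed le.

Definition eventually_le (P : L -> Prop) := exists l0, forall l, le l0 l -> P l.

Lemma eventually_and P Q :
  eventually_le P -> eventually_le Q -> eventually_le (fun l => P l /\ Q l).
Proof.
move=> [a ha] [b hb]; have [_ [tr [_ ub]]] := dir; have [c [ac bc]] := ub a b.
by exists c => l cl; split; [exact/ha/(tr _ _ _ ac)|exact/hb/(tr _ _ _ bc)].
Qed.

Lemma eventually_all (P : nat -> L -> Prop) n : (forall i, eventually_le (P i)) ->
  eventually_le (fun l => forall i, (i < n)%N -> P i l).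
Proof.
move=> hP; elim: n => [|n ih].
  by have [_ [_ [[l _] _]]] := dir; exists l.
have [l0 h] := eventually_and ih (hP n); exists l0 => l /h[hi hn] i.
by rewrite ltnS leq_eqVlt => /predU1P[->|/hi].
Qed.

Lemma eventually_ex P : eventually_le P -> exists l, P l.
Proof. by move=> [l h]; exists l; apply: h; exact: dir.1. Qed.

Definition net_cvg (a : L -> R) (x : R) :=
  forall c, 0 < c -> eventually_le (fun l => `|x - a l| < c).

Lemma net_cvg_cst x : net_cvg (fun=> x) x.
Proof.
move=> c c0; have [_ [_ [[l _] _]]] := dir.
by exists l => l' _; rewrite subrr normr0.
Qed.

Lemma net_cvg_unique a b x y : net_cvg a x -> net_cvg b y ->
  eventually_le (fun l => a l = b l) -> x = y.
Proof.
move=> ax by_ ab; apply/eqP; rewrite -subr_eq0; apply/eqP; apply: eps_eq0 => c c0.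
have c20 : 0 < c / 2 by rewrite divr_gt0.
have [l [[h1 h2] h3]] := eventually_ex (eventually_and (eventually_and (ax _ c20) (by_ _ c20)) ab).
move: h1 h2; rewrite h3 !ltr_norml ler_norml => /andP[? ?] /andP[? ?].
by apply/andP; split; lra.
Qed.

Lemma monotone_net_cauchy (a : L -> R) (c : R) : (forall l, 0 <= a l <= 1) ->
  (forall l m, le l m -> a l <= a m) -> 0 < c ->
  exists l0, forall l, le l0 l -> a l - a l0 < c.
Proof.
move=> a01 mono c0.
have hs : has_sup (range a).
  split; last by exists 1 => _ [l _ <-]; have /andP[] := a01 l.
  by have [_ [_ [[l _] _]]] := dir; exists (a l); exists l.
have [_ [l0 _ <-] hl0] := sup_adherent c0 hs.
exists l0 => l ll.
have : a l <= sup (range a) by apply: ub_le_sup; [exact: hs.2|exists l].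
by move: (sup _) hl0 => s; lra.
Qed.

End nets.

Section kernel_net_extension.
Context (R : realType) d1 d2 (X : measurableType d1) (Y : measurableType d2).
Context (p : probability X R) (L : Type) (le : L -> L -> Prop).
Hypothesis dir : directed le.
Implicit Types (kl : L -> R.-pker X ~> Y) (k : R.-pker X ~> Y).

Let p1 : p setT = 1%E. Proof. exact: probability_setT. Qed.

Definition l1cvg kl k := forall B, measurable B -> forall e : R, 0 < e ->
  eventually_le le (fun l => l1 p (kval k B) (kval (kl l) B) < e).

Definition l1cauchy kl := forall B, measurable B -> forall e : R, 0 < e ->
  exists l0, forall l, le l0 l -> l1 p (kval (kl l) B) (kval (kl l0) B) < e.

Lemma kop_dist_le k k' u n (c : R) : unitf u ->
  (forall i, (i < n.+1)%N -> l1 p (kval k (layer u n i)) (kval k' (layer u n i)) <= c) ->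
  l1 p (kop k u) (kop k' u) <= n.+1%:R^-1 *+ 2 + c.
Proof.
move=> uu hc; apply: (le_trans (kop_dist k k' n p1 uu)); rewrite lerD2l.
rewrite ler_pdivrMl//.
apply: (@le_trans _ _ (\sum_(i < n.+1) c)); first by apply: ler_sum => i _; exact: hc.
by rewrite sumr_const card_ord mulr_natl.
Qed.

Lemma l1cvg_kop kl k u (e : R) : l1cvg kl k -> unitf u -> 0 < e ->
  eventually_le le (fun l => l1 p (kop k u) (kop (kl l) u) < e).
Proof.
move=> klk uu e0; have e40 : 0 < e / 4 by rewrite divr_gt0.
have [n hn] := natSinv_lt e40.
have [l0 h] := @eventually_all _ _ dir
    (fun i l => l1 p (kval k (layer u n i)) (kval (kl l) (layer u n i)) < e / 4) n.+1
    (fun i => klk _ (measurable_layer n i uu) _ e40).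
exists l0 => l /h hl.
have := kop_dist_le uu (fun i ni => ltW (hl i ni)).
by move: (l1 _ _ _) (n.+1%:R^-1) hn => x y; lra.
Qed.

Lemma l1cauchy_kop kl u (e : R) : l1cauchy kl -> unitf u -> 0 < e ->
  exists l0, forall l, le l0 l -> l1 p (kop (kl l) u) (kop (kl l0) u) < e.
Proof.
(* Each layer costs at most [e / 4], by a detour through its own index [a i], and the staircase
   error at most twice [e / 8]. *)
move=> ckl uu e0; have e80 : 0 < e / 8 by rewrite divr_gt0.
have [n hn] := natSinv_lt e80.
have mB i := measurable_layer n i uu.
have bB l i : bdm (kval (kl l) (layer u n i)) by exact/unitf_bdm/unitf_kval.
have /choice[a ha] : forall i, exists l0, forall l, le l0 l ->
    l1 p (kval (kl l) (layer u n i)) (kval (kl l0) (layer u n i)) < e / 8.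
  by move=> i; exact: ckl.
have [l0 h] := @eventually_all _ _ dir
    (fun i l => l1 p (kval (kl l) (layer u n i)) (kval (kl (a i)) (layer u n i)) < e / 8) n.+1
    (fun i => ex_intro _ (a i) (ha i)).
exists l0 => l ll.
have hc i : (i < n.+1)%N ->
    l1 p (kval (kl l) (layer u n i)) (kval (kl l0) (layer u n i)) <= e / 4.
  move=> ni; have := h _ ll i ni; have := h _ (dir.1 l0) i ni.
  have := l1_tri p (bB l i) (bB (a i) i) (bB l0 i).
  rewrite [l1 p (kval (kl (a i)) _) _]l1_sym.
  by move: (l1 _ _ _) (l1 _ _ _) (l1 _ _ _) => x y z; lra.
have := kop_dist_le uu hc.
by move: (l1 _ _ _) (n.+1%:R^-1) hn => x y; lra.
Qed.

End kernel_net_extension.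

(** * Realising the limit on an essentially standard Borel space *)

Section limit_in_ess_std_borel.
Context (R : realType) d (X : measurableType d) (p : probability X R).
Context (L : Type) (le : L -> L -> Prop).

Let p1 : p setT = 1%E. Proof. exact: probability_setT. Qed.

Lemma kop_kdirac d1 d2 (Y : measurableType d1) (W : measurableType d2) (s : Y -> W)
  (ms : measurable_fun setT s) (u : W -> R) : unitf u -> kop (kdirac ms) u = u \o s.
Proof.
move=> uu; apply/funext => y; apply: EFin_inj; rewrite kop_EFin//.
rewrite integral_dirac//; last by apply/measurable_EFinP; exact: uu.1.
by rewrite diracT mul1e.
Qed.

(** A measure-preserving kernel does not increase L1 distance. An argument is called for because a
    single measure [e x] may charge the exceptional null set. *)
Lemma l1_kop_ae (e : R.-pker X ~> X) u v : meas_pres p p e -> unitf u -> unitf v ->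
  {ae p, forall x, u x = v x} -> l1 p (kop e u) (kop e v) = 0.
Proof.
move=> mpe uu uv uv_ae.
have uw : unitf (fun x => `|u x - v x|).
  split; first by apply: measurableT_comp => //; apply: measurable_funB; [exact: uu.1|exact: uv.1].
  move=> x; rewrite normr_ge0/= ler_norml.
  by have /andP[? ?] := uu.2 x; have /andP[? ?] := uv.2 x; apply/andP; split; lra.
have bu := unitf_bdm uu; have bv := unitf_bdm uv.
apply/le_anti/andP; split; last by apply: Rintegral_ge0.
have -> : 0 = \int[p]_x `|u x - v x|.
  rewrite -[LHS](bdm_int_cst p1 0); apply: bdm_ae_int => //; [exact: bdm_cst|exact: unitf_bdm|].
  by apply: filterS uv_ae => x ->; rewrite subrr normr0.
rewrite -(meas_pres_kop mpe uw); apply: bdm_le_int => //.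
- by apply/bdm_norm/bdmB; exact/unitf_bdm/unitf_kop.
- exact/unitf_bdm/unitf_kop.
move=> x; have k1 := pker1 e x; rewrite /kop -bdm_intB//.
by apply: bdm_int_norm => //; exact: bdmB.
Qed.

Lemma ess_std_borel_limit (el : L -> R.-pker X ~> X) : ess_std_borel p -> directed le ->
  (forall l, meas_pres p p (el l)) -> l1cauchy p le el ->
  exists e : R.-pker X ~> X, l1cvg p le el e.
Proof.
move=> [d' [Y [q [sbY [k [h [_ [_ [hk _]]]]]]]]] dir mpe cel.
have [s [g [ms s01 mg gs]]] := standard_borel_retract sbY.
have ms' : measurable_fun setT (s : Y -> measurableTypeR R) by exact: ms.
have mg' : measurable_fun setT (g : measurableTypeR R -> Y) by exact: mg.
(* [S] leads to the line through [Y] and [G] leads back; as [g] retracts [s], [S] followed by [G]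
   amounts to [k] followed by [h], almost surely the identity. *)
pose S : R.-pker X ~> measurableTypeR R := pkcomp (kdirac ms') k.
pose G : R.-pker measurableTypeR R ~> X := pkcomp h (kdirac mg').
pose T l : R.-pker X ~> measurableTypeR R := pkcomp S (el l).
have SE x C : measurable C -> kval S C x = \int[k x]_y \1_C (s y).
  by move=> mC; rewrite kval_pkcomp// -kop_indic// kop_kdirac//; exact: unitf_indic.
have TE l C : measurable C -> kval (T l) C = kop (el l) (kval S C).
  by move=> mC; rewrite kval_pkcomp.
have [||||K TK] := @net_limit R d X p L le T dir.
- move=> l x r r0; have mr : measurable (`]-oo, r]%classic : set (measurableTypeR R)).
    exact: measurable_itv.
  rewrite -kvalK// TE//; congr EFin; rewrite /kop.
  rewrite -[RHS](bdm_int_cst (pker1 (el l) x) 0); apply: eq_Rintegral => z _.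
  rewrite SE// -[RHS](bdm_int_cst (pker1 k z) 0); apply: eq_Rintegral => y _.
  rewrite indicE memNset//= in_itv/=; apply/negP; rewrite -ltNge.
  by apply: (lt_le_trans r0); have /andP[] := s01 y.
- move=> l x r r2; have mr : measurable (`]-oo, r]%classic : set (measurableTypeR R)).
    exact: measurable_itv.
  rewrite -kvalK// TE//; congr EFin; rewrite /kop.
  rewrite -[RHS](bdm_int_cst (pker1 (el l) x) 1); apply: eq_Rintegral => z _.
  rewrite SE// -[RHS](bdm_int_cst (pker1 k z) 1); apply: eq_Rintegral => y _.
  rewrite indicE mem_set//= in_itv/=; have /andP[_] := s01 y; move: (s y) => t; lra.
(* Since every [el l] preserves [p], the marginal of [T l] is that of [S]. *)
- by move=> l l' C mC; rewrite !TE// !meas_pres_kop//; exact: unitf_kval.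
- move=> C e mC e0; have [l0 h0] := l1cauchy_kop dir cel (unitf_kval S mC) e0.
  by exists l0 => l /h0; rewrite !TE.
exists (pkcomp G K) => B mB e e0.
have uG : unitf (kval G B) by exact: unitf_kval.
have [l0 h0] := @l1cvg_kop _ _ _ _ _ p L le dir T K _ e TK uG e0.
exists l0 => l /h0; rewrite kval_pkcomp//.
have -> : kop (T l) (kval G B) = kop (el l) (kop S (kval G B)) by rewrite kop_pkcomp.
have SG : kop S (kval G B) = kop k (kval h B).
  rewrite kop_pkcomp// kop_kdirac//; congr kop; apply/funext => y /=.
  rewrite kval_pkcomp// kop_kdirac/=; first by rewrite gs.
  exact: unitf_kval.
have uSG := unitf_kop S uG.
(* The round trip through the line changes [el l] only by a null function, so the limit of the [T l]
   followed by [G] is a limit of the [el l]. *)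
have z0 : l1 p (kop (el l) (kop S (kval G B))) (kval (el l) B) = 0.
  have := l1_kop_ae (mpe l) uSG (unitf_indic R mB); rewrite (kop_indic (el l) mB); apply.
  apply: filterS (hk B mB) => x; rewrite /kid diracE => hx.
  apply: EFin_inj; rewrite indicE -hx SG kop_EFin; last exact: unitf_kval.
  by apply: eq_integral => y _; rewrite kvalK.
have bd (f : X -> R) : unitf f -> bdm f by exact: unitf_bdm.
have := l1_tri p (bd _ (unitf_kop K uG)) (bd _ (unitf_kop (el l) uSG))
  (bd _ (unitf_kval (el l) mB)).
rewrite z0 addr0; exact: le_lt_trans.
Qed.

End limit_in_ess_std_borel.

(** * Limits of idempotents, and the order *)

Section limits_of_idempotents.
Context (R : realType) d (X : measurableType d) (p : probability X R).
Context (L : Type) (le : L -> L -> Prop) (el : L -> R.-pker X ~> X) (e : R.-pker X ~> X).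
Hypothesis dir : directed le.
Hypothesis ele : l1cvg p le el e.
Hypothesis sel : forall l, selfadj p (el l).

Let p1 : p setT = 1%E. Proof. exact: probability_setT. Qed.

Let uk (k : R.-pker X ~> X) B : measurable B -> unitf (kval k B).
Proof. exact: unitf_kval. Qed.

(** Pairing with a weight between 0 and 1 does not increase L1 distance. *)
Lemma net_cvg_weight w B : unitf w -> measurable B ->
  net_cvg le (fun l => \int[p]_x (w x * kval (el l) B x)) (\int[p]_x (w x * kval e B x)).
Proof.
move=> uw mB c c0; have [l0 h] := ele mB c0; exists l0 => l /h; apply: le_lt_trans.
have bw k : bdm (fun x => w x * kval k B x) by apply/unitf_bdm/unitfM => //; exact: uk.
have bk (k : R.-pker X ~> X) : bdm (kval k B) by exact/unitf_bdm/uk.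
rewrite -bdm_intB//; apply: (le_trans (bdm_int_norm p1 (bdmB (bw _) (bw _)))).
apply: bdm_le_int => //; [exact/bdm_norm/bdmB|exact/bdm_norm/bdmB|].
move=> x; rewrite -mulrBr normrM ler_piMl//.
by have /andP[? ?] := uw.2 x; rewrite ger0_norm.
Qed.

(** The difference of products is split so that one factor changes at a time, the other being at
    most 1. *)
Lemma net_cvg_prod A B : measurable A -> measurable B ->
  net_cvg le (fun l => \int[p]_x (kval (el l) A x * kval (el l) B x))
    (\int[p]_x (kval e A x * kval e B x)).
Proof.
move=> mA mB c c0; have c20 : 0 < c / 2 by rewrite divr_gt0.
have [l0 h] := eventually_and dir (ele mA c20) (ele mB c20).
exists l0 => l /h[hA hB].
have bk (k : R.-pker X ~> X) C : measurable C -> bdm (kval k C).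
  by move=> mC; exact/unitf_bdm/uk.
have bm (k : R.-pker X ~> X) : bdm (fun x => kval k A x * kval k B x).
  by apply: bdmM; exact: bk.
have bd C : measurable C -> bdm (fun x => `|kval e C x - kval (el l) C x|).
  by move=> mC; apply/bdm_norm/bdmB; exact: bk.
apply: (@le_lt_trans _ _ (l1 p (kval e A) (kval (el l) A) +
                          l1 p (kval e B) (kval (el l) B))); last first.
  by move: (l1 _ _ _) (l1 _ _ _) hA hB => a b; lra.
rewrite -bdm_intB//; apply: (le_trans (bdm_int_norm p1 (bdmB (bm _) (bm _)))).
rewrite -bdm_intD//; [|exact: bd|exact: bd].
apply: bdm_le_int => //; [exact/bdm_norm/bdmB|by apply: bdmD; exact: bd|].
move=> x.
have -> : kval e A x * kval e B x - kval (el l) A x * kval (el l) B x =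
    (kval e A x - kval (el l) A x) * kval e B x +
    kval (el l) A x * (kval e B x - kval (el l) B x) by ring.
apply: (le_trans (ler_normD _ _)); rewrite !normrM lerD//.
  by rewrite ler_piMr//; have /andP[? ?] := (uk e mB).2 x; rewrite ger0_norm.
by rewrite ler_piMl//; have /andP[? ?] := (uk (el l) mA).2 x; rewrite ger0_norm.
Qed.

Lemma limit_selfadj : selfadj p e.
Proof.
move=> A B mA mB.
apply: (net_cvg_unique dir (net_cvg_weight (unitf_indic R mA) mB)
                           (net_cvg_weight (unitf_indic R mB) mA)).
by have [_ [_ [[l _] _]]] := dir; exists l => l' _; exact: sel.
Qed.

Lemma limit_below_diag : (forall l, below p (el l) (el l)) -> below p e e.
Proof.
move=> bel A B mA mB.
apply: (net_cvg_unique dir (net_cvg_prod mA mB) (net_cvg_weight (unitf_indic R mA) mB)).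
by have [_ [_ [[l _] _]]] := dir; exists l => l' _; exact: bel.
Qed.

(** As [f] is fixed, [kval f A] is the weight and the other side is constant. *)
Lemma limit_belowr f : eventually_le le (fun l => below p f (el l)) -> below p f e.
Proof.
move=> [l0 h] A B mA mB.
apply: (net_cvg_unique dir (net_cvg_weight (uk f mA) mB) (net_cvg_cst dir _)).
by exists l0 => l /h; exact.
Qed.

(** Here the limit occurs on both sides; commuting the product makes [kval f B] the weight of one
    and [\1_A] that of the other. *)
Lemma limit_belowl f : eventually_le le (fun l => below p (el l) f) -> below p e f.
Proof.
move=> [l0 h] A B mA mB; under eq_Rintegral do rewrite mulrC.
apply: (net_cvg_unique dir (net_cvg_weight (uk f mB) mA) (net_cvg_weight (unitf_indic R mA) mB)).
by exists l0 => l /h <-//; apply: eq_Rintegral => x _; rewrite mulrC.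
Qed.

Lemma l1cvg_conv1 d' (Y : measurableType d') (kl : L -> R.-pker X ~> Y) (k : R.-pker X ~> Y) :
  l1cvg p le kl k -> Defs.conv1 p le kl k.
Proof.
move=> klk B mB c c0; have [l0 h] := klk B mB c c0; exists l0 => l /h.
rewrite -lte_fin; congr (_ < _)%E; rewrite bdm_EFin//; last first.
  by apply/bdm_norm/bdmB; exact/unitf_bdm/unitf_kval.
by apply: eq_integral => x _; rewrite -!kvalK.
Qed.

Lemma limit_conv2 : conv2 p p le el e.
Proof.
split; first exact: l1cvg_conv1.
move=> klp kp bkl bk; apply: l1cvg_conv1 => B mB c c0.
have [l0 h] := ele mB c0; exists l0 => l /h; congr (_ < _).
apply: bdm_ae_int => //; try by apply/bdm_norm/bdmB; exact/unitf_bdm/uk.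
(* Both inverses agree almost surely with the kernels themselves, so the second half of [conv2]
   repeats the first. *)
apply: filterS2 (bayes_inv_ae limit_selfadj bk mB) (bayes_inv_ae (@sel l) (bkl l) mB).
by move=> x -> ->.
Qed.

End limits_of_idempotents.

Lemma idem_net_limit (R : realType) d (X : measurableType d) (p : probability X R)
    (L : Type) (le : L -> L -> Prop) (el : L -> R.-pker X ~> X) :
  ess_std_borel p -> directed le -> (forall l, dagger_idem p (el l)) ->
  (forall l m, le l m -> below p (el l) (el m)) \/
  (forall l m, le l m -> below p (el m) (el l)) ->
  exists e, [/\ dagger_idem p e, l1cvg p le el e & conv2 p p le el e].
Proof.
move=> sb dir del mono.
have sel l : selfadj p (el l) by have [] := (dagger_idemP p (el l)).1 (del l).
have bel l : below p (el l) (el l) by have [] := (dagger_idemP p (el l)).1 (del l).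
have cel : l1cauchy p le el.
  move=> B mB c c0; have c20 : 0 < c ^+ 2 by rewrite exprn_gt0.
  case: mono => mono.
    have [||l0 h0] := @monotone_net_cauchy _ _ _ dir (fun l => diag p (el l) B) _ _ _ c20.
    - by move=> l; exact: diag01.
    - by move=> l m lm; apply: below_le => //; exact: mono.
    - by exists l0 => l ll; apply: below_l1 => //; [exact: mono|exact: h0].
  (* For a decreasing net the complements [1 - diag] increase and stay in the unit interval. *)
  have [||l0 h0] := @monotone_net_cauchy _ _ _ dir (fun l => 1 - diag p (el l) B) _ _ _ c20.
  - move=> l; have := diag01 p (el l) mB; move: (diag _ _ _) => x /andP[? ?].
    by apply/andP; split; lra.
  - by move=> l m lm; rewrite lerD2l lerN2; apply: below_le => //; exact: mono.
  - exists l0 => l ll; rewrite l1_sym; apply: below_l1 => //; first exact: mono.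
    by have := h0 _ ll; move: (diag _ _ _) (diag _ _ _) (_ ^+ 2) => x y z; lra.
have mpe l : meas_pres p p (el l) by exact: selfadj_meas_pres.
have [e ele] := ess_std_borel_limit sb dir mpe cel.
exists e; split => //; last exact: limit_conv2.
apply/dagger_idemP; split; [exact: limit_selfadj ele sel|exact: limit_below_diag ele bel].
Qed.

Theorem theorem6p9 (R : realType) (d : measure_display) (X : measurableType d)
  (p : probability X R) :
  ess_std_borel p ->
  (forall (L : Type) (le : L -> L -> Prop) (el : L -> R.-pker X ~> X),
    directed le ->
    (forall l, dagger_idem p (el l)) ->
    (forall l m, le l m -> idem_le p (el l) (el m)) ->
    (exists f, dagger_idem p f /\ forall l, idem_le p (el l) f) ->
    exists e, is_sup_idem p el e /\ conv2 p p le el e) /\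
  (forall (L : Type) (le : L -> L -> Prop) (el : L -> R.-pker X ~> X),
    directed le ->
    (forall l, dagger_idem p (el l)) ->
    (forall l m, le l m -> idem_le p (el m) (el l)) ->
    (exists f, dagger_idem p f /\ forall l, idem_le p f (el l)) ->
    exists e, is_inf_idem p el e /\ conv2 p p le el e).
Proof.
have sa e : dagger_idem p e -> selfadj p e by move=> /dagger_idemP[].
move=> sb; split=> L le el dir del mono _.
- have mono' l m : le l m -> below p (el l) (el m).
    by move=> lm; apply/idem_leP; [exact: sa|exact: sa|exact: mono].
  have [e [de ele ce]] := idem_net_limit sb dir del (or_introl mono').
  exists e; split => //; split => //; split.
    move=> l; apply/idem_leP; [exact: sa|exact: sa|].
    (* For fixed [l] the relation holds at every index beyond [l], and the limit inherits it on the
       right. *)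
    by apply: (limit_belowr dir ele); exists l => m; exact: mono'.
  move=> f df elf; apply/idem_leP; [exact: sa|exact: sa|].
  (* An upper bound [f] dominates every member, which the limit inherits on the left: hence
     leastness. *)
  apply: (limit_belowl dir ele); have [_ [_ [[l _] _]]] := dir; exists l => m _.
  by apply/idem_leP; [exact: sa|exact: sa|exact: elf].
- have mono' l m : le l m -> below p (el m) (el l).
    by move=> lm; apply/idem_leP; [exact: sa|exact: sa|exact: mono].
  have [e [de ele ce]] := idem_net_limit sb dir del (or_intror mono').
  exists e; split => //; split => //; split.
    move=> l; apply/idem_leP; [exact: sa|exact: sa|].
    by apply: (limit_belowl dir ele); exists l => m; exact: mono'.
  move=> f df elf; apply/idem_leP; [exact: sa|exact: sa|].
  apply: (limit_belowr dir ele); have [_ [_ [[l _] _]]] := dir; exists l => m _.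
  by apply/idem_leP; [exact: sa|exact: sa|exact: elf].
Qed.
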